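(* For every infinite cardinal $\gamma$, the space $L_\gamma\times L_\gamma$ is homeomorphic to $\langle L_\gamma,\prec\rangle\times_l\langle L_\gamma,\prec\rangle$.
   Context: Ordinals carry their order topology. For linearly ordered sets $Y,Z$ (in particular linearly ordered topological spaces), $Y\times_l Z$ denotes the set of pairs ordered lexicographically ($\langle a,b\rangle<\langle c,d\rangle$ iff $a<c$, or $a=c$ and $b<d$), endowed with the order topology of this lexicographical order. $\times$ denotes the usual product with the product topology. Let $\gamma$ be an infinite cardinal. Denote by $\lambda_\gamma$ the ordinal $(\gamma\times_l\gamma)+1$. Definition of $L_\gamma$: $L_\gamma$ is the subspace (with the subspace topology) of $\lambda_\gamma$ consisting of all points $\alpha\in\lambda_\gamma$ that satisfy at least one of: (1) $\alpha=\max\lambda_\gamma$; (2) the interval $[\alpha_0,\alpha]$ of ordinals is order-isomorphic to $\gamma+1$ for some $\alpha_0<\alpha$; (3) $\alpha$ is isolated (in $\lambda_\gamma$). Definition of the linear order $\prec$ on $L_\gamma$: if $\gamma=\omega$, then $L_\gamma=\lambda_\gamma$ and $\prec$ is the usual ordinal order $<$. If $\gamma>\omega$, then for each $\alpha\in\lambda_\gamma\setminus L_\gamma$ put $R_\alpha=\{\alpha+1,\alpha+2,\dots\}$ (all $\alpha+n$ with $1\le n<\omega$) and define $\prec_\alpha$ on $R_\alpha$ by $\cdots\prec_\alpha\alpha+5\prec_\alpha\alpha+3\prec_\alpha\alpha+1\prec_\alpha\alpha+2\prec_\alpha\alpha+4\prec_\alpha\cdots$. For $x,y\in L_\gamma$,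 $x\prec y$ holds iff either $x,y\in R_\alpha$ for some $\alpha\in\lambda_\gamma\setminus L_\gamma$ and $x\prec_\alpha y$, or $\{x,y\}$ is not a subset of $R_\alpha$ for any $\alpha\in\lambda_\gamma\setminus L_\gamma$ and $x<y$. *)

(* Defs.v *)
From HB Require Import structures.
From mathcomp Require Import all_boot all_order.
From mathcomp Require Import wochoice all_classical.
From mathcomp Require Import interval topology.

Set Implicit Arguments.
Unset Strict Implicit.
Unset Printing Implicit Defensive.

Import Order.TTheory.

Local Open Scope classical_set_scope.
Local Open Scope card_scope.
Local Open Scope order_scope.

(* An infinite cardinal is an infinite initial ordinal: an infinite well-order
   none of whose proper initial segments has the cardinality of the whole. *)
HB.mixin Record isInfiniteCardinal d T & Order.Total d T := {
  card_well_order : well_order (<=%O : rel T);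
  card_infinite : infinite_set [set: T];
  card_initial : forall a : T, ~ ([set: T] #<= [set x : T | x < a])
}.

#[short(type="infiniteCardinalType")]
HB.structure Definition InfiniteCardinal d :=
  { T of Order.Total d T & isInfiniteCardinal d T }.

(* The ordinal T + 1: None is the point added on top of the copy Some of T. *)
Definition adjoin_top (T : Type) : Type := option T.

HB.instance Definition _ (T : choiceType) :=
  Choice.copy (adjoin_top T) (option T).

Section AdjoinTop.
Context {d : Order.disp_t} {T : orderType d}.

Definition adjoin_top_lt (x y : adjoin_top T) : bool :=
  match x, y with
  | Some a, Some b => a < b
  | Some _, None => true
  | None, _ => false
  end.

Fact adjoin_top_lt_irr : irreflexive adjoin_top_lt.
Proof. by case=> //= a; rewrite ltxx. Qed.

Fact adjoin_top_lt_trans : transitive adjoin_top_lt.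
Proof. by case=> [a|] [b|] [c|] //=; exact: lt_trans. Qed.

HB.instance Definition _ :=
  Order.Lt_isPOrder.Build d (adjoin_top T)
    adjoin_top_lt_irr adjoin_top_lt_trans.

Lemma adjoin_top_ltE (x y : adjoin_top T) : (x < y) = adjoin_top_lt x y.
Proof. by []. Qed.

Fact adjoin_top_total : total (<=%O : rel (adjoin_top T)).
Proof.
move=> x y; rewrite !le_eqVlt !adjoin_top_ltE; case: x y => [a|] [b|] //=.
by rewrite !(inj_eq Some_inj) -!le_eqVlt; exact: le_total.
Qed.

HB.instance Definition _ :=
  Order.POrder_isTotal.Build d (adjoin_top T) adjoin_top_total.

End AdjoinTop.

Definition lambda d (gamma : infiniteCardinalType d) : Type :=
  order_topology (adjoin_top (gamma *l gamma)).

HB.instance Definition _ d (gamma : infiniteCardinalType d) :=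
  OrderTopological.copy (lambda gamma)
    (order_topology (adjoin_top (gamma *l gamma))).

Section Definitions.
Context {d : Order.disp_t} (gamma : infiniteCardinalType d).
Implicit Types a x y : lambda gamma.

Definition max_lambda : lambda gamma := None.

(* [a0, a] is order-isomorphic to gamma + 1 for some a0 < a. *)
Definition gamma_limit a : Prop :=
  exists2 a0 : lambda gamma, a0 < a &
    exists2 f : adjoin_top gamma -> lambda gamma,
      {mono f : u v / u <= v} & range f = [set x | a0 <= x <= a].

Definition Lset : set (lambda gamma) := [set a |
  [\/ a = max_lambda, gamma_limit a | isolated [set: lambda gamma] a]].

(* The ordinal successor a + 1, with the default max_lambda at max_lambda. *)
Definition osucc a : lambda gamma :=
  xget a [set b | a < b /\ forall c, a < c -> b <= c].

(* a + n *)
Definition oadd a (n : nat) : lambda gamma := iter n osucc a.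

Definition Rblock a : set (lambda gamma) :=
  [set x | exists2 n : nat, (0 < n)%N & x = oadd a n].

(* The order ... 5, 3, 1, 2, 4, ... of the positive integers. *)
Definition zigzag_lt (m n : nat) : bool :=
  match odd m, odd n with
  | true, true => (n < m)%N
  | true, false => true
  | false, true => false
  | false, false => (m < n)%N
  end.

Definition prec_block a x y : Prop :=
  exists m n : nat, [/\ (0 < m)%N, (0 < n)%N, x = oadd a m, y = oadd a n
    & zigzag_lt m n].

(* The first branch is the case gamma = omega: an infinite cardinal is omega if
   and only if it is countable. *)
Definition prec (x y : set_type Lset) : Prop :=
  if `[< countable [set: gamma] >] then (val x < val y : Prop)
  else
    (exists a, [/\ ~ Lset a, Rblock a (val x), Rblock a (val y)
      & prec_block a (val x) (val y)])
    \/ ((forall a, ~ Lset a -> ~ (Rblock a (val x) /\ Rblock a (val y)))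
        /\ val x < val y).

End Definitions.

Arguments Lset {d} gamma _.

Section PrecTotal.
Context {d : Order.disp_t} (gamma : infiniteCardinalType d).

Lemma card_ex_min (A : set gamma) : A !=set0 ->
  exists2 m, A m & forall x, A x -> m <= x.
Proof.
move=> [x Ax]; have [] := @card_well_order d gamma (mem A).
  by exists x; rewrite inE.
move=> m [[Am lbm] _]; exists m; first by move: Am; rewrite inE.
by move=> y Ay; apply: lbm; rewrite inE.
Qed.

Lemma card_no_max (m : gamma) : exists x : gamma, m < x.
Proof.
apply: contrapT => /forallNP nomax.
have lem x : x <= m by rewrite leNgt; exact/negP.
have infA : infinite_set [set x : gamma | x < m].
  apply: (@sub_infinite_set _ ([set: gamma] `\` [set m])); last first.
    by apply: infinite_setD; [exact: card_infinite | exact: finite_set1].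
  by move=> x [_ /= xm]; rewrite lt_neqAle lem andbT; exact/eqP.
have /infiniteP/card_leP[h] := infA.
pose f (n : nat) : gamma := val (h (SigSub (in_setT n))).
have f_lt n : f n < m by have := set_valP (h (SigSub (in_setT n))).
have f_inj : injective f.
  move=> i j /val_inj e; have := @inj _ _ _ h (SigSub (in_setT i))
    (SigSub (in_setT j)); rewrite !in_setT => /(_ isT isT e).
  by move=> /(congr1 val).
apply: (@card_initial d gamma m).
pose g x := if x == m then f 0%N else
  if pselect (exists n, f n = x) is left h then f (sval (cid h)).+1 else x.
have g_lt x : g x < m.
  rewrite /g; case: eqP => [//|/eqP xm]; case: pselect => // _.
  by rewrite lt_neqAle xm lem.
have g_inj : injective g.
  move=> x y; rewrite /g.
  case: eqP => [->|xm]; case: eqP => [->//|ym].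
  - by case: pselect => [? /f_inj//|+ e]; case; exists 0%N.
  - by case: pselect => [? /f_inj//|+ e]; case; exists 0%N.
  case: pselect => [i|i]; case: pselect => [j|j] //.
  - move=> /f_inj[]; case: (cid i) => k /= <-.
    by case: (cid j) => l /= <- ->.
  - by move=> e; case: j; exists (sval (cid i)).+1.
  - by move=> e; case: i; exists (sval (cid j)).+1.
suff [k] : $|{injfun [set: gamma] >-> [set x : gamma | x < m]}|.
  exact: inj_card_le k.
apply/injfunPex; exists g => [x _|x y _ _]; [exact: g_lt | exact: g_inj].
Qed.

Implicit Types a b c x y z : lambda gamma.

Lemma lambda_ex_min (A : set (lambda gamma)) : A !=set0 ->
  exists2 m, A m & forall x, A x -> m <= x.
Proof.
move=> [x Ax]; have [[[p0 q0] Ap]|noS] :=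
  pselect (exists p : gamma *l gamma, A (Some p)); last first.
  exists x => // y Ay; case: y Ay => [p Ap|_]; first by case: noS; exists p.
  by case: (x) => // p; rewrite le_eqVlt orbT.
have [|p [q' Apq'] lep] := @card_ex_min [set p | exists q, A (Some (p, q))].
  by exists p0, q0.
have [|q Apq leq] := @card_ex_min [set q | A (Some (p, q))].
  by exists q'.
exists (Some (p, q)) => // -[[r s]|] Ay; last by rewrite le_eqVlt orbT.
have pr : p <= r by apply: lep; exists s.
suff : ((p, q) : gamma *l gamma) <= (r, s).
  by rewrite le_eqVlt => /predU1P[-> //|h]; apply: ltW.
rewrite leEprodlexi /= pr /=; apply/implyP => rp.
have e : p = r by apply/le_anti; rewrite pr rp.
by apply: leq; rewrite /= e.
Qed.

Lemma le_max_lambda x : x <= max_lambda gamma.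
Proof. by case: x => // p; rewrite le_eqVlt orbT. Qed.

Lemma osuccP a : a != max_lambda gamma ->
  a < osucc a /\ forall c, a < c -> osucc a <= c.
Proof.
move=> am; rewrite /osucc; case: xgetP => [b _ //|nob].
have [|b ab lb] := @lambda_ex_min [set b | a < b]; last by case: (nob b).
by exists (max_lambda gamma); rewrite /= lt_neqAle am le_max_lambda.
Qed.

Lemma osucc_neq_max a : a != max_lambda gamma ->
  osucc a != max_lambda gamma.
Proof.
move=> am; have [_ lb] := osuccP am.
case: a am lb => [[p q]|//] _ lb; apply/eqP => e.
have [r qr] := card_no_max q.
have : (Some (p, q) : lambda gamma) < Some (p, r).
  suff : ((p, q) : gamma *l gamma) < (p, r) by [].
  by rewrite ltEprodlexi /= lexx.
by move=> /lb; rewrite e.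
Qed.

Lemma osucc_isolated a : a != max_lambda gamma ->
  isolated [set: lambda gamma] (osucc a).
Proof.
move=> am; have sm := osucc_neq_max am.
have [a_lt a_lb] := osuccP am; have [s_lt s_lb] := osuccP sm.
split; first by rewrite inE.
exists (`]a, (osucc (osucc a))[%classic); last first.
  rewrite setIT; apply/seteqP; split => [x /=|_ ->]; rewrite /= in_itv /=.
    move=> /andP[ax xs]; apply/le_anti; rewrite a_lb// andbT.
    by rewrite leNgt; apply/negP => /s_lb; rewrite leNgt xs.
  by rewrite a_lt s_lt.
by apply: open_nbhs_nbhs; split; [exact: itv_open | rewrite /= in_itv /= a_lt].
Qed.

Lemma nL_neq_max a : ~ Lset gamma a -> a != max_lambda gamma.
Proof. by move=> La; apply/eqP => e; apply: La; constructor 1. Qed.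

Lemma oadd_neq_max a n : ~ Lset gamma a -> oadd a n != max_lambda gamma.
Proof.
move=> La; elim: n => [|n]; [exact: nL_neq_max | exact: osucc_neq_max].
Qed.

Lemma oaddP a n : ~ Lset gamma a -> oadd a n < oadd a n.+1 /\
  forall c, oadd a n < c -> oadd a n.+1 <= c.
Proof. by move=> /oadd_neq_max => /(_ n); exact: osuccP. Qed.

Lemma oadd_lt a m n : ~ Lset gamma a -> (m < n)%N -> oadd a m < oadd a n.
Proof.
move=> La; elim: n => // n IH; rewrite ltnS leq_eqVlt => /predU1P[->|/IH mn].
  by case: (oaddP n La).
by apply: lt_trans mn _; case: (oaddP n La).
Qed.

Lemma oadd_inj a : ~ Lset gamma a -> injective (oadd a).
Proof.
move=> La m n e.
by case: (ssrnat.ltngtP m n) => // /(oadd_lt La); rewrite e ltxx.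
Qed.

Lemma Rblock_gt a x : ~ Lset gamma a -> Rblock a x -> a < x.
Proof. by move=> La [n n0 ->]; exact: (oadd_lt La n0). Qed.

Lemma Rblock_down a x y : ~ Lset gamma a ->
  a < x -> x <= y -> Rblock a y -> Rblock a x.
Proof.
move=> La ax xy [n _ e]; move: xy; rewrite {}e; elim: n => [|n IH] xn.
  by move: ax; rewrite ltNge xn.
have [xn'|nx] := leP x (oadd a n); first exact: IH.
exists n.+1 => //; apply/le_anti; rewrite xn /=.
by case: (oaddP n La) => _; apply.
Qed.

Lemma oadd_eq a b m n : ~ Lset gamma a -> ~ Lset gamma b ->
  oadd a m = oadd b n -> a = b.
Proof.
move=> La Lb; elim: m n => [|m IH] [|n] //.
- move=> /= e; case: La; constructor 3; rewrite e.
  exact/osucc_isolated/oadd_neq_max.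
- move=> /= e; case: Lb; constructor 3; rewrite -e.
  exact/osucc_isolated/oadd_neq_max.
move=> e; apply: (IH n).
have [am leam] := oaddP m La; have [bn lebn] := oaddP n Lb.
case: (ltgtP (oadd a m) (oadd b n)) => // [/leam|/lebn].
  by rewrite e leNgt bn.
by rewrite -e leNgt am.
Qed.

Lemma Rblock_inj a b x : ~ Lset gamma a -> ~ Lset gamma b ->
  Rblock a x -> Rblock b x -> a = b.
Proof. by move=> La Lb [m _ ->] [n _]; exact: oadd_eq. Qed.

Lemma zigzag_irr : irreflexive zigzag_lt.
Proof. by move=> n; rewrite /zigzag_lt; case: odd; rewrite ltnn. Qed.

Lemma zigzag_trans : transitive zigzag_lt.
Proof.
move=> n m p; rewrite /zigzag_lt.
case: (odd m); case: (odd n); case: (odd p) => // mn np.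
  exact: ltn_trans np mn.
exact: ltn_trans mn np.
Qed.

Lemma zigzag_total m n : m != n -> zigzag_lt m n || zigzag_lt n m.
Proof.
rewrite /zigzag_lt neq_ltn.
by case: (odd m); case: (odd n) => //; rewrite orbC.
Qed.

Implicit Types u v w : set_type (Lset gamma).

Lemma prec_irr u : ~ prec u u.
Proof.
rewrite /prec; case: ifP => _; first by rewrite ltxx.
case=> [[a [La _ _ [m [n [_ _ -> /(oadd_inj La) ->]]]]]|[_]].
  by rewrite zigzag_irr.
by rewrite ltxx.
Qed.

Lemma prec_trans v u w : prec u v -> prec v w -> prec u w.
Proof.
rewrite /prec; case: ifP => _; first exact: lt_trans.
move: (val u) (val v) (val w) => x y z.
case=> [[a [La ax ay axy]]|[nxy xy]].
  case=> [[b [Lb by_ bz byz]]|[nyz yz]].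
    have e := Rblock_inj La Lb ay by_; rewrite -{}e {b Lb by_} in bz byz.
    left; exists a; split=> //.
    case: axy => m [n [m0 _ ex ey mn]]; case: byz => n' [p [_ p0 ey' ez np]].
    exists m, p; split => //; apply: zigzag_trans mn _.
    by rewrite (oadd_inj La (etrans (esym ey) ey')).
  have naz : ~ Rblock a z by move=> az; apply: (nyz a).
  right; split.
    by move=> b Lb [bx bz]; apply: naz; rewrite (Rblock_inj La Lb ax bx).
  rewrite ltNge; apply/negP => zx; apply: naz; apply: (Rblock_down La _ zx ax).
  exact: lt_trans (Rblock_gt La ay) yz.
case=> [[b [Lb by_ bz byz]]|[nyz yz]].
  have nbx : ~ Rblock b x by move=> bx; apply: (nxy b).
  right; split.
    by move=> a La [ax az]; apply: nbx; rewrite (Rblock_inj Lb La bz az).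
  rewrite ltNge; apply/negP => zx; apply: nbx.
  apply: (Rblock_down Lb _ (ltW xy) by_).
  exact: lt_le_trans (Rblock_gt Lb bz) zx.
right; split; last exact: lt_trans yz.
move=> a La [ax az]; apply: (nxy a La); split => //.
exact: Rblock_down La (lt_trans (Rblock_gt La ax) xy) (ltW yz) az.
Qed.

Lemma prec_total u v : u <> v -> prec u v \/ prec v u.
Proof.
move=> uv; have {uv} : val u != val v by apply/eqP => /val_inj.
rewrite /prec; case: ifP => _; first by rewrite neq_lt => /orP.
move: (val u) (val v) => x y xy.
have [[a [La [ax ay]]]|nE] :=
    pselect (exists a, ~ Lset gamma a /\ (Rblock a x /\ Rblock a y)); last first.
  move: xy; rewrite neq_lt => /orP[xy|yx]; [left|right]; right; split=> //.
    by move=> a La Ra; apply: nE; exists a.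
  by move=> a La [? ?]; apply: nE; exists a.
have [m m0 em] := ax; have [n n0 en] := ay.
have mn : m != n by apply: contraNneq xy => e; rewrite em en e.
have /orP[h|h] := zigzag_total mn; [left|right]; left; exists a; split => //.
  by exists m, n.
by exists n, m.
Qed.

End PrecTotal.

(* The set Lset gamma ordered by prec, to be kept apart from the topological
   space set_type (Lset gamma). *)
Definition Lprec d (gamma : infiniteCardinalType d) : Type :=
  set_type (Lset gamma).

HB.instance Definition _ d (gamma : infiniteCardinalType d) :=
  Choice.copy (Lprec gamma) (set_type (Lset gamma)).

Section LprecOrder.
Context {d : Order.disp_t} {gamma : infiniteCardinalType d}.

Definition Lprec_lt (x y : Lprec gamma) : bool := `[< prec x y >].

Fact Lprec_lt_irr : irreflexive Lprec_lt.
Proof. by move=> x; apply/asboolP; exact: prec_irr. Qed.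

Fact Lprec_lt_trans : transitive Lprec_lt.
Proof.
by move=> y x z /asboolP xy /asboolP yz; apply/asboolP; exact: prec_trans yz.
Qed.

HB.instance Definition _ :=
  Order.Lt_isPOrder.Build d (Lprec gamma) Lprec_lt_irr Lprec_lt_trans.

Lemma Lprec_ltE (x y : Lprec gamma) : (x < y) = `[< prec x y >].
Proof. by []. Qed.

Fact Lprec_total : total (<=%O : rel (Lprec gamma)).
Proof.
move=> x y; have [->|/eqP xy] := eqVneq x y; first by rewrite lexx.
rewrite !le_eqVlt !Lprec_ltE.
by case: (prec_total xy) => /asboolT ->; rewrite !orbT.
Qed.

HB.instance Definition _ :=
  Order.POrder_isTotal.Build d (Lprec gamma) Lprec_total.

End LprecOrder.

Definition homeomorphic (X Y : topologicalType) : Prop :=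
  exists (f : X -> Y) (g : Y -> X),
    [/\ cancel f g, cancel g f, continuous f & continuous g].

(* Main.v *)
Require Import Defs.
From mathcomp Require Import all_boot all_order all_classical topology.
From mathcomp Require Import interval zify.

(** Let S(X) be a point together with gamma disjoint copies of X, indexed by
    gamma and converging to the point: its neighbourhoods are the sets containing
    a tail of the sequence of copies.  With S_0 a point and S_(n+1) = S(S_n),
    both spaces are homeomorphic to S_4.

    A tail of gamma is isomorphic to gamma, hence S_n absorbs a summand S_m with
    m < n; and gamma x 2 (lexicographically) is isomorphic to gamma, hence
    S(X + X) = S(X).  L_gamma is S_2 plus an isolated point, so S_2.  Peeling
    S(X) x S(Y) along the diagonal yields
    S(X) x S(Y) = S(X x S(Y) + S(X) x Y), whence S_m x S_n = S_(m+n).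

    In the lexicographic square, the row of a point x is a copy of S_2.  It is
    clopen if x is the least element or a successor for prec; otherwise x is the
    limit of a gamma-sequence of such points, and the first point of its row is the
    limit of their rows.  So the rows in one block {a} x gamma form a copy of
    S_3 = S(S_2), and these copies converge to the first point of the last row. *)

Set Implicit Arguments.
Unset Strict Implicit.
Unset Printing Implicit Defensive.

Import Order.TTheory.

Local Open Scope classical_set_scope.
Local Open Scope card_scope.
Local Open Scope order_scope.

(** * Ordinals below gamma *)

Section Ordinals.
Context {d : Order.disp_t} {gamma : infiniteCardinalType d}.
Implicit Types x y z l : gamma.

Lemma card_lt_wf : well_founded (fun x y => x < y).
Proof.
move=> x; apply: contrapT => nx.
have [|m nm lem] := @card_ex_min d gamma [set y | ~ Acc (fun x y => x < y) y].
  by exists x.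
apply: nm; constructor => y ym; apply: contrapT => ny.
by have := lem y ny; rewrite leNgt ym.
Qed.

(** The initiality of gamma enters below only through this form and [card_no_max]: an assumption is
    refuted by injecting gamma into a proper initial segment. *)
Lemma card_no_embedding (g : gamma -> gamma) m :
  injective g -> (forall x, g x < m) -> False.
Proof.
move=> g_inj g_lt; apply: (@card_initial d gamma m).
suff [k] : $|{injfun [set: gamma] >-> [set x : gamma | x < m]}|.
  exact: inj_card_le k.
by apply/injfunPex; exists g => [x _|x y _ _]; [exact: g_lt|exact: g_inj].
Qed.

Fact card_ex_zero : exists z : gamma, forall x, z <= x.
Proof.
have [x _] := infinite_setN0 (@card_infinite d gamma).
have [|m _ lem] := @card_ex_min d gamma [set: gamma]; first by exists x.
by exists m => y; apply: lem.
Qed.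

Definition zero : gamma := sval (cid card_ex_zero).

Lemma zero_le x : zero <= x.
Proof. exact: (svalP (cid card_ex_zero)). Qed.

Lemma lt_zero x : (x < zero) = false.
Proof. by rewrite ltNge zero_le. Qed.

Fact card_ex_suc x : exists y, forall z, (y <= z) = (x < z).
Proof.
have [|m xm lem] := @card_ex_min d gamma [set y | x < y]; first exact: card_no_max.
exists m => z; apply/idP/idP; last exact: lem.
exact: lt_le_trans.
Qed.

Definition suc x : gamma := sval (cid (card_ex_suc x)).

Lemma suc_le x y : (suc x <= y) = (x < y).
Proof. exact: (svalP (cid (card_ex_suc x))). Qed.

Lemma lt_suc x y : (x < suc y) = (x <= y).
Proof. by rewrite ltNge suc_le leNgt. Qed.

Lemma suc_gt x : x < suc x. Proof. by rewrite lt_suc. Qed.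

Lemma suc_ltE x y : (suc x < suc y) = (x < y).
Proof. by rewrite lt_suc suc_le. Qed.

Lemma suc_inj : injective suc.
Proof.
by move=> x y e; apply/le_anti; rewrite -lt_suc -e suc_gt -lt_suc e suc_gt.
Qed.

Lemma suc_gt0 x : zero < suc x.
Proof. by rewrite lt_suc zero_le. Qed.

(** Zero counts as a limit, so that every ordinal below gamma is l + n for a unique such l and a
    unique natural number n. *)
Definition islim l := forall y, suc y <> l.

Lemma zero_lim : islim zero.
Proof. by move=> y e; have := suc_gt0 y; rewrite e ltxx. Qed.

Lemma lim_suc l x : islim l -> (suc x < l) = (x < l).
Proof.
by move=> ll; rewrite lt_neqAle suc_le andb_idl// => _; apply/eqP.
Qed.

Lemma lim_iter l x n : islim l -> (iter n suc x < l) = (x < l).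
Proof. by move=> ll; elim: n => //= n <-; rewrite lim_suc. Qed.

Lemma iter_suc_lt x m n : (iter m suc x < iter n suc x) = (m < n)%N.
Proof.
elim: m n => [|m IH] [|n] /=; rewrite ?ltxx//.
- rewrite ltnS leq0n; elim: n => [|n IH] /=; first exact: suc_gt.
  exact: lt_trans IH (suc_gt _).
- apply/negbTE; rewrite -leNgt ltW//; elim: m {IH} => [|m IH] /=; first exact: suc_gt.
  exact: lt_trans IH (suc_gt _).
- by rewrite suc_ltE IH ltnS.
Qed.

Lemma lim_nat_lt l l' m n : islim l -> islim l' ->
  (iter m suc l < iter n suc l') = (l < l') || ((l == l') && (m < n)%N).
Proof.
move=> ll ll'; case: (ltgtP l l') => [h|h|->] /=.
- rewrite -(lim_iter l m ll') in h; apply: lt_le_trans h _.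
  by elim: n => //= n /le_trans; apply; exact/ltW/suc_gt.
- apply/negbTE; rewrite -leNgt ltW//.
  rewrite -(lim_iter l' n ll) in h; apply: lt_le_trans h _.
  by elim: m => //= m /le_trans; apply; exact/ltW/suc_gt.
- by rewrite iter_suc_lt.
Qed.

Fact lim_nat_ex x : exists ln : gamma * nat, islim ln.1 /\ iter ln.2 suc ln.1 = x.
Proof.
elim/(well_founded_ind card_lt_wf): x => x IH.
have [[y yx]|nl] := pselect (exists y, suc y = x); last first.
  by exists (x, 0%N); split=> // y yx; apply: nl; exists y.
have [|[l n] [ll e]] := IH y; first by rewrite -yx suc_gt.
by exists (l, n.+1); split => //=; rewrite e.
Qed.

Definition lpart x : gamma := (sval (cid (lim_nat_ex x))).1.
Definition npart x : nat := (sval (cid (lim_nat_ex x))).2.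

Lemma lpart_lim x : islim (lpart x).
Proof. exact: (svalP (cid (lim_nat_ex x))).1. Qed.
Hint Resolve lpart_lim : core.

Lemma lnpartK x : iter (npart x) suc (lpart x) = x.
Proof. exact: (svalP (cid (lim_nat_ex x))).2. Qed.

Lemma lnpart_lt x y : (x < y) =
  (lpart x < lpart y) || ((lpart x == lpart y) && (npart x < npart y)%N).
Proof. by rewrite -[in LHS](lnpartK x) -[in LHS](lnpartK y) lim_nat_lt. Qed.

(** Two decompositions of one ordinal agree because [lim_nat_lt], used in both directions, excludes
    either strict comparison. *)
Lemma lnpart_iter l n : islim l ->
  lpart (iter n suc l) = l /\ npart (iter n suc l) = n.
Proof.
move=> ll; set x := iter n suc l.
have xx : iter (npart x) suc (lpart x) = iter n suc l by rewrite lnpartK.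
have := lim_nat_lt (npart x) n (@lpart_lim x) ll.
have := lim_nat_lt n (npart x) ll (@lpart_lim x).
rewrite xx ltxx; case: ltgtP => //= -> h1 h2; split => //.
by move: h1 h2; case: (ssrnat.ltngtP n (npart x)).
Qed.

Lemma lpart_iter l n : islim l -> lpart (iter n suc l) = l.
Proof. by move=> /(lnpart_iter n)[]. Qed.

Lemma npart_iter l n : islim l -> npart (iter n suc l) = n.
Proof. by move=> /(lnpart_iter n)[]. Qed.

Lemma lnpart_inj x y : lpart x = lpart y -> npart x = npart y -> x = y.
Proof. by move=> e1 e2; rewrite -(lnpartK x) -(lnpartK y) e1 e2. Qed.

Lemma lpart_suc x : lpart (suc x) = lpart x.
Proof. by rewrite -[x in LHS]lnpartK -iterS lpart_iter. Qed.

Lemma npart_suc x : npart (suc x) = (npart x).+1.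
Proof. by rewrite -[x in LHS]lnpartK -iterS npart_iter. Qed.

(* The ordinal 2 * x + i, where 2 * (l + n) = l + 2 * n for l a limit or 0. *)
Definition dbl x (i : bool) : gamma := iter ((npart x).*2 + i) suc (lpart x).

Lemma dbl_lt x y i j : (dbl x i < dbl y j) = (x < y) || ((x == y) && (i < j)%N).
Proof.
rewrite /dbl lim_nat_lt// [x < y]lnpart_lt.
have -> : (x == y) = (lpart x == lpart y) && (npart x == npart y).
  apply/eqP/andP => [->|[/eqP e1 /eqP e2]]; [by rewrite !eqxx|exact: lnpart_inj].
case: ltgtP => //= _.
by case: (ssrnat.ltngtP (npart x)) => h /=; case: i; case: j => /=; lia.
Qed.

Lemma dbl_inj x y i j : dbl x i = dbl y j -> x = y /\ i = j.
Proof.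
move=> e; have := dbl_lt x y i j; have := dbl_lt y x j i; rewrite e ltxx.
by case: ltgtP => //= ->; case: i {e}; case: j.
Qed.

Lemma dbl_surj y : exists x i, y = dbl x i.
Proof.
exists (iter (npart y)./2 suc (lpart y)), (odd (npart y)).
by rewrite /dbl lpart_iter// npart_iter// addnC odd_double_half lnpartK.
Qed.

(* The sum xi + x if it is below gamma, and the junk value xi otherwise. *)
Definition oplus xi : gamma -> gamma :=
  Fix card_lt_wf (fun=> gamma) (fun x rec =>
    xget xi [set y | (xi <= y /\ forall z (zx : z < x), rec z zx < y) /\
      forall y', xi <= y' -> (forall z (zx : z < x), rec z zx < y') -> y <= y']).

Lemma oplusE xi x : oplus xi x =
    xget xi [set y | (xi <= y /\ forall z, z < x -> oplus xi z < y) /\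
      forall y', xi <= y' -> (forall z, z < x -> oplus xi z < y') -> y <= y'].
Proof.
rewrite /oplus Fix_eq// => {}x f g fg; congr xget; apply/funext => y.
have -> // : f = g by apply/functional_extensionality_dep => z; apply/funext.
Qed.

Lemma oplusP xi x (A := [set y | xi <= y /\ forall z, z < x -> oplus xi z < y]) :
  A !=set0 -> A (oplus xi x) /\ forall y, A y -> oplus xi x <= y.
Proof.
move=> /card_ex_min[m Am lem]; rewrite oplusE; case: xgetP => [y -> [Ay ley]|ny].
  by split => // y' [? ?]; apply: ley.
by case: (ny m); split => // y' ? ?; apply: lem.
Qed.

(* f x = xi + x.  If some sum xi + x were not below gamma then gamma would consist
   of the ordinals below xi and of sums xi + z with z < x, and would embed in the
   ordinals below the double of max xi x. *)
Lemma tail_iso xi : exists f : gamma -> gamma,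
  [/\ forall x y, (f x < f y) = (x < y), forall x, xi <= f x
   & forall y, xi <= y -> exists x, f x = y].
Proof.
pose A x := [set y | xi <= y /\ forall z, z < x -> oplus xi z < y].
(* The least z with y <= xi + z gives y itself: all earlier sums are below y, so y is one of the
   candidates of which xi + z is the least. *)
have onto x y : xi <= y -> (forall z, z < x -> A z !=set0) -> ~ A x y ->
    exists2 z, z < x & oplus xi z = y.
  move=> xiy A0 nAxy.
  have [|z [zx yz] lez] := @card_ex_min d gamma [set z | z < x /\ y <= oplus xi z].
    apply: contrapT => h; apply: nAxy; split=> // z zx; rewrite ltNge.
    by apply/negP => yz; apply: h; exists z.
  exists z => //; apply/le_anti; rewrite yz andbT.
  have [_] := oplusP (A0 z zx); apply; split => // t tz; rewrite ltNge.
  apply/negP => yt; have := lez t (conj (lt_trans tz zx) yt).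
  by rewrite leNgt tz.
have A0 x : A x !=set0.
  elim/(well_founded_ind card_lt_wf): x => x IH; apply: contrapT => Ax0.
  have /choice[g gP] : forall y, exists z, xi <= y -> z < x /\ oplus xi z = y.
    move=> y; have [xiy|yxi] := leP xi y; last by exists xi.
    have [|z] := onto x y xiy IH; first by move=> Axy; apply: Ax0; exists y.
    by exists z.
  pose h y := if y < xi then dbl y false else dbl (g y) true.
  apply: (@card_no_embedding h (dbl (Order.max xi x) false)).
    move=> y y'; rewrite /h; case: ltP => yxi; case: ltP => yxi' /dbl_inj[]//.
    by move=> e _; rewrite -(gP y yxi).2 e (gP y' yxi').2.
  move=> y; rewrite /h; case: (ltP y xi) => yxi; rewrite dbl_lt lt_max.
    by rewrite yxi.
  by rewrite (gP y yxi).1 orbT.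
have mono x y : x < y -> oplus xi x < oplus xi y.
  by move=> xy; have [[_ h] _] := oplusP (A0 y); exact: h.
exists (oplus xi); split.
- move=> x y; case: (ltgtP x y) => [/mono->//|/mono h|->]; last by rewrite ltxx.
  by apply/negbTE; rewrite -leNgt ltW.
- by move=> x; have [[]] := oplusP (A0 x).
(* It suffices that y <= xi + y, for then y is not above all sums xi + z with z <= y. The inequality
   holds since a strictly increasing map of gamma lowers no ordinal. *)
move=> y xiy; have [|z _ <-] := onto (suc y) y xiy (fun z _ => A0 z); last by exists z.
case=> _ /(_ y); rewrite suc_gt => /(_ isT); apply/negP; rewrite -leNgt.
elim/(well_founded_ind card_lt_wf): {xiy} y => y IH; rewrite leNgt; apply/negP => h.
by have := IH _ h; rewrite leNgt mono.
Qed.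

(** All finite ordinals lie below a nonzero limit l, so a countable gamma would embed below l. *)
Lemma countable_lim l : countable [set: gamma] -> islim l -> l = zero.
Proof.
move=> cg ll; apply/eqP; rewrite eq_le zero_le andbT leNgt; apply/negP => l0.
have /card_leP[f] := cg.
have [g gi] : exists g : gamma -> nat, injective g.
  exists (fun x => val (f (SigSub (in_setT x)))) => x y /val_inj e.
  have := @inj _ _ _ f (SigSub (in_setT x)) (SigSub (in_setT y)).
  by rewrite !in_setT => /(_ isT isT e) [].
apply: (@card_no_embedding (fun x => iter (g x) suc zero) l).
  move=> x y /(congr1 npart); rewrite !npart_iter; [exact: gi|exact: zero_lim..].
by move=> x; rewrite lim_iter.
Qed.

(** With no limit above x, every ordinal from the limit part of x on would be this limit part plus a
    natural number. These ordinals form a tail, which is isomorphic to gamma, so gamma would be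
    countable. *)
Lemma uncountable_lim x : ~ countable [set: gamma] -> exists2 l, islim l & x < l.
Proof.
move=> nc; apply: contrapT => nl; apply: nc.
have [f [fmono fge fsurj]] := tail_iso (lpart x).
have lpf y : lpart (f y) = lpart x.
  apply/le_anti/andP; split; last first.
    rewrite leNgt; apply/negP => h.
    have := fge y; rewrite leNgt => /negP; apply.
    by rewrite -[f y]lnpartK lim_iter.
  rewrite leNgt; apply/negP => h; apply: nl; exists (lpart (f y)) => //.
  by rewrite -[x]lnpartK lim_iter.
have [k] : $|{injfun [set: gamma] >-> [set: nat]}|.
  apply/injfunPex; exists (fun y => npart (f y)) => // y y' _ _ e.
  have fe : f y = f y' by apply: lnpart_inj => //; rewrite !lpf.
  by case: (ltgtP y y') => //; rewrite -fmono fe ltxx.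
exact: inj_card_le k.
Qed.
End Ordinals.

(** * Iterated stars *)

Section Stars.
Context {d : Order.disp_t} {gamma : infiniteCardinalType d}.
Implicit Types (xi eta : gamma).

Section Def.
Context {X : topologicalType}.
Implicit Types (p : X) (P : gamma -> set X) (A B : set X).

Definition tail p P xi : set X :=
  [set x | x = p \/ exists2 eta, xi <= eta & P eta x].

Definition star p P A :=
  [/\ A = tail p P zero, (forall xi, ~ P xi p),
    (forall xi eta x, P xi x -> P eta x -> xi = eta),
    (forall xi, nbhs p (tail p P xi))
  & (forall U, nbhs p U -> exists xi, tail p P xi `<=` U)].

(* [A] is open in [X] and homeomorphic to S_n. *)
Fixpoint nstar n A : Prop :=
  if n is n'.+1 then
    exists p P, star p P A /\ forall xi, nstar n' (P xi)
  else exists2 x, A = [set x] & nbhs x A.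

Lemma tail_sub p P xi eta : xi <= eta -> tail p P eta `<=` tail p P xi.
Proof.
by move=> xe x [->|[z ez Pz]]; [left|right; exists z => //; apply: le_trans ez].
Qed.

Lemma tail0P p P x : tail p P zero x <-> x = p \/ exists xi, P xi x.
Proof.
split=> [] [->|]; [by left| |by left|]; first by case=> z _ ?; right; exists z.
by case=> z ?; right; exists z => //; apply: zero_le.
Qed.

Lemma nstar_nbhs n A x : nstar n A -> A x -> nbhs x A.
Proof.
elim: n A x => [|n IH] A x /=; first by case=> y -> yA ->.
case=> p [P [[-> _ _ pN _] PN]] [->//|[z _ Pz]].
by apply: filterS (IH _ _ (PN z) Pz) => y Py; right; exists z => //; apply: zero_le.
Qed.

(** Lets the pieces be indexed by any set in bijection with gamma. It serves to renumber a tail, to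
    insert a new piece, and to merge the two families of pieces of a product. *)
Lemma nstar_reindex (I : Type) (P : I -> set X) (k : I -> gamma) n p A :
    injective k -> (forall y, exists i, k i = y) ->
    (forall x, A x <-> x = p \/ exists i, P i x) ->
    (forall i, ~ P i p) -> (forall i j x, P i x -> P j x -> i = j) ->
    (forall i, nstar n (P i)) ->
    (forall y, nbhs p [set x | x = p \/ exists2 i, y <= k i & P i x]) ->
    (forall U, nbhs p U -> exists y, forall i, y <= k i -> P i `<=` U) ->
  nstar n.+1 A.
Proof.
move=> k_inj /choice[h kh] AE pP PI PN pN pU; exists p, (P \o h); split; last first.
  by move=> xi; exact: PN.
have hk i : h (k i) = i by apply: k_inj; rewrite kh.
split=> [|xi|xi eta x Px Py|xi|U /[dup] Up /pU[y yU]].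
- apply/seteqP; split=> x.
    by move=> /AE[->|[i Pi]]; [left|right; exists (k i); rewrite ?zero_le //= hk].
  by move=> [->|[z _ Pz]]; apply/AE; [left|right; exists (h z)].
- exact: pP.
- by rewrite -(kh xi) -(kh eta) (PI _ _ _ Px Py).
- apply: filterS (pN xi) => x [->|[i ik Pi]]; [by left|right].
  by exists (k i) => //=; rewrite hk.
- exists y => x [->|[z yz Pz]]; first exact: nbhs_singleton.
  by apply: (yU (h z)) => //; rewrite kh.
Qed.

(** The remaining pieces are renumbered along the isomorphism of [tail_iso]. *)
Lemma nstar_tail n p P A xi : star p P A -> (forall eta, nstar n (P eta)) ->
  nstar n.+1 (tail p P xi).
Proof.
move=> [_ pP PI pN pU] PN; have [f [fmono fge fsurj]] := tail_iso xi.
have fle x y : (f x <= f y) = (x <= y) by rewrite !leNgt fmono.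
apply: (@nstar_reindex _ (P \o f) id n p) => //.
- by move=> y; exists y.
- move=> x; split=> [] [->|]; [by left| |by left|].
    by move=> [z /fsurj[y <-] Pz]; right; exists y.
  by move=> [y Py]; right; exists (f y).
- by move=> i; exact: pP.
- move=> i j x Pi Pj; have fij := PI _ _ _ Pi Pj.
  by case: (ltgtP i j) => //; rewrite -fmono fij ltxx.
- by move=> i; exact: PN.
- move=> y; apply: filterS (pN (f y)) => x [->|[z yz Pz]]; [by left|right].
  have /fsurj[t tz] : xi <= z by apply: le_trans yz.
  by exists t; rewrite /= ?tz// -fle tz.
- move=> U /pU[y yU].
  have [t ft] : exists t, y <= f t.
    have [xiy|yxi] := leP xi y; first by have [t <-] := fsurj y xiy; exists t.
    by exists zero; apply: le_trans (ltW yxi) _.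
  exists t => i ti x Px; apply: yU; right; exists (f i) => //.
  by apply: le_trans ft _; rewrite fle.
Qed.

(** B becomes piece number zero, and the old pieces move up along the isomorphism of gamma with its
    tail from one on. *)
Lemma nstar_absorb1 n A B : nstar n B -> nstar n.+1 A -> A `&` B = set0 ->
  nstar n.+1 (A `|` B).
Proof.
move=> BN [p [P [[AE pP PI pN pU] PN]]] AB0.
have AB x : A x -> B x -> False.
  by move=> ? ?; have : (A `&` B) x by []; rewrite AB0.
have PA i x : P i x -> A x by move=> Px; rewrite AE; apply/tail0P; right; exists i.
have [f [fmono fge fsurj]] := tail_iso (@suc _ gamma zero).
have fle x y : (f x <= f y) = (x <= y) by rewrite !leNgt fmono.
have f0 x : zero < f x by rewrite -suc_le.
apply: (@nstar_reindex _ (oapp P B) (oapp f zero) n p).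
- move=> [x|] [y|] //=.
  + by move=> e; congr Some; case: (ltgtP x y) => //; rewrite -fmono e ltxx.
  + by move=> e; have := f0 x; rewrite e ltxx.
  + by move=> e; have := f0 y; rewrite -e ltxx.
- move=> y; have [y0|y0] := leP y zero.
    by exists None => /=; apply/le_anti; rewrite zero_le y0.
  by rewrite -suc_le in y0; have [x <-] := fsurj y y0; exists (Some x).
- rewrite AE => x; split.
    by move=> [/tail0P[->|[i Pi]]|Bx]; [left|right; exists (Some i)|right; exists None].
  move=> [->|[[i|] /= Pi]]; [by left; left| |by right].
  by left; apply/tail0P; right; exists i.
- move=> [i|] //=; apply: AB; rewrite AE; by left.
- move=> [i|] [j|] x //= Pi Pj; first by rewrite (PI _ _ _ Pi Pj).
    by case: (AB x) => //; exact: PA Pi.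
  by case: (AB x) => //; exact: PA Pj.
- by case.
- move=> y; have [t ft] : exists t, y <= f t.
    have [|] := leP (suc zero) y; first by move=> /fsurj[t <-]; exists t.
    by rewrite lt_suc => y0; exists zero; apply: le_trans y0 _; apply: zero_le.
  apply: filterS (pN t) => x [->|[i ti Pi]]; [by left|right; exists (Some i) => //=].
  by apply: le_trans ft _; rewrite fle.
(* As [f y] is above zero, B is left out of this tail. *)
- move=> U /pU[y yU]; exists (f y) => [] [i|] /=.
    by rewrite fle => yi x Px; apply: yU; right; exists i.
  by rewrite leNgt f0.
Qed.

(** If m + 1 = n, then B is a further piece. Otherwise B is absorbed by piece number zero,
    inductively; the tails beyond that piece do not change. *)
Lemma nstar_absorb m n A B : (m < n)%N -> nstar m B -> nstar n A -> A `&` B = set0 ->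
  nstar n (A `|` B).
Proof.
elim: n A B => // n IH A B; rewrite ltnS leq_eqVlt => /predU1P[->|mn].
  exact: nstar_absorb1.
move=> BN [p [P [[AE pP PI pN pU] PN]]] AB0.
have AB x : A x -> B x -> False.
  by move=> ? ?; have : (A `&` B) x by []; rewrite AB0.
have PA i x : P i x -> A x by move=> Px; rewrite AE; apply/tail0P; right; exists i.
exists p, (fun xi => if xi == zero then (P zero `|` B)%classic else P xi);
  split; last first.
  move=> xi; case: eqP => _; last exact: PN.
  apply: IH => //; first exact: PN.
  by apply/seteqP; split=> // x [/PA]; exact: AB.
split.
- apply/seteqP; split=> x; rewrite AE.
    move=> [/tail0P[->|[xi Px]]|Bx]; [by left|right|right].
      by exists xi; rewrite ?zero_le//; case: eqP => // <-; left.
    by exists zero; rewrite ?eqxx //; right.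
  move=> [->|[xi _]]; first by left; left.
  by case: eqP => [_ [Px|Bx]|_ Px]; [left; right; exists zero|right|
     left; right; exists xi; rewrite ?zero_le].
- move=> xi; have Ap : A p by rewrite AE; left.
  by case: eqP => // _ [/pP//|]; exact: AB.
- move=> xi eta x; case: eqP => [->|_]; case: eqP => [->|_]//.
  + move=> [Px|Bx] Py; first exact: PI Py.
    by case: (AB x) => //; exact: PA Py.
  + move=> Px [Py|By]; first exact: PI Py.
    by case: (AB x) => //; exact: PA Px.
  + exact: PI.
- move=> xi; apply: filterS (pN xi) => x [->|[eta xe Px]]; [by left|right].
  by exists eta => //; case: eqP => // <-; left.
(* Starting at a successor leaves the enlarged piece zero out. *)
- move=> U /pU[xi xU]; exists (suc xi) => x [->|[eta xe]]; first by apply: xU; left.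
  case: eqP => [e|_ Px]; first by move: xe; rewrite e suc_le lt_zero.
  by apply: xU; right; exists eta => //; apply: le_trans xe; apply/ltW/suc_gt.
Qed.

End Def.

(** The condition on neighbourhoods says that i is continuous and open. It is applied to the slices
    of a product at an isolated point. *)
Lemma nstar_embed (X Y : topologicalType) (i : X -> Y) n (A : set X) : injective i ->
  (forall x U, nbhs (i x) U <-> nbhs x (i @^-1` U)) -> nstar n A -> nstar n (i @` A).
Proof.
move=> i_inj ni; elim: n A => [|n IH] A /=.
  move=> [x -> nx]; exists (i x); first by rewrite image_set1.
  apply/ni; apply: filterS nx => y ->; by exists x.
move=> [p [P [[AE pP PI pN pU] PN]]]; exists (i p), (fun xi => i @` P xi); split.
  split.
  - rewrite AE; apply/seteqP; split=> y.
      move=> [x [->|[eta _ Px]] <-]; first by left.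
      by right; exists eta; rewrite ?zero_le//; exists x.
    move=> [->|[eta _ [x Px <-]]]; first by exists p => //; left.
    by exists x => //; right; exists eta; rewrite ?zero_le.
  - by move=> xi [x Px /i_inj e]; apply: (pP xi); rewrite -e.
  - by move=> xi eta _ [x Px <-] [y Py /i_inj e]; apply: (PI _ _ x) => //; rewrite -e.
  - move=> xi; apply/ni; apply: filterS (pN xi) => x [->|[eta xe Px]]; [by left|right].
    by exists eta => //; exists x.
  - move=> U /ni/pU[xi xU]; exists xi => y [->|[eta xe [x Px <-]]].
      by apply: (xU p); left.
    by apply: xU; right; exists eta.
by move=> xi; exact: IH.
Qed.

(** * Products of iterated stars *)

Lemma nbhs_pairl (X Y : topologicalType) (x : X) (y : Y) (U : set (X * Y)) :
  nbhs x [set x] -> nbhs (x, y) U <-> nbhs y (pair x @^-1` U).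
Proof.
move=> nx; split=> [[[V W] /= [Vx Wy] VW]|Uy].
  by apply: filterS Wy => z Wz; apply: VW; split => //=; exact: nbhs_singleton.
by exists ([set x], pair x @^-1` U) => //= -[a b] [/= ->].
Qed.

Lemma nbhs_pairr (X Y : topologicalType) (x : X) (y : Y) (U : set (X * Y)) :
  nbhs y [set y] -> nbhs (x, y) U <-> nbhs x (pair^~ y @^-1` U).
Proof.
move=> ny; split=> [[[V W] /= [Vx Wy] VW]|Ux].
  by apply: filterS Vx => z Vz; apply: VW; split => //=; exact: nbhs_singleton.
by exists (pair^~ y @^-1` U, [set y]) => //= -[a b] [/= ? ->].
Qed.

Lemma nstar_prod (X Y : topologicalType) m n (A : set X) (B : set Y) :
  nstar m A -> nstar n B -> nstar (m + n) (A `*` B).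
Proof.
elim: m n A B => [|m IHm] n A B.
  move=> [x -> nx] BN; rewrite add0n.
  have -> : [set x] `*` B = pair x @` B.
    by apply/seteqP; split=> [[a b] [/= -> Bb]|_ [b Bb <-]//]; exists b.
  by apply: nstar_embed => // [a b []//|y U]; exact: nbhs_pairl.
elim: n A B => [|n IHn] A B AN.
  move=> [y -> ny]; rewrite addn0.
  have -> : A `*` [set y] = pair^~ y @` A.
    by apply/seteqP; split=> [[a b] [/= Aa ->]|_ [b Bb <-]//]; exists a.
  by apply: nstar_embed => // [a b []//|x U]; exact: nbhs_pairr.
have := AN => -[p [P [Ps PN]]]; move=> BN; have := BN => -[q [Q [Qs QN]]].
have [AE pP PI pN pU] := Ps; have [BE qQ QI qN qU] := Qs.
rewrite addSn.
(* A point of [P s] times [Q t] goes to piece (s, false) if s <= t and to (t, true) if t < s; the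
   centres p and q count as lying beyond all indices. The [suc] keeps the two families disjoint. *)
pose R (i : gamma * bool) := if i.2 then tail p P (suc i.1) `*` Q i.1
                             else P i.1 `*` tail q Q i.1.
have PQI xi eta a b : P xi a -> tail q Q xi b -> tail p P (suc eta) a -> Q eta b -> False.
  move=> Pa [->|[t xt Qt]] [ap|[s es Ps']] Qb; try by [case: (qQ eta)].
    by rewrite ap in Pa; exact: (pP _ Pa).
  move: xt es; rewrite (QI _ _ _ Qt Qb) (PI _ _ _ Ps' Pa) suc_le => h.
  by rewrite ltNge h.
have RE xi a b : tail p P xi a -> tail q Q xi b -> (a, b) = (p, q) \/
    exists2 i : gamma * bool, xi <= i.1 & R i (a, b).
  move=> [->|[s xs Pa]] [->|[t xt Qb]]; first by left.
  - by right; exists (t, true) => //; split => //; left.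
  - by right; exists (s, false) => //; split => //; left.
  - right; have [st|ts] := leP s t.
      by exists (s, false) => //; split => //; right; exists t.
    by exists (t, true) => //; split => //; right; exists s; rewrite ?suc_le.
apply: (@nstar_reindex _ _ R (fun i => dbl i.1 i.2) (m + n.+1) (p, q)).
- by move=> [x i] [y j] /= /dbl_inj[-> ->].
- by move=> y; have [x [i ->]] := dbl_surj y; exists (x, i).
- move=> [a b]; split.
    rewrite AE BE => -[/= /RE aP /aP [->|[i _ Ri]]]; first by left.
    by right; exists i.
  move=> [[-> ->]|[[x []] /= [/= Ha Hb]]]; rewrite AE BE; split => /=; try (by left).
  + exact: tail_sub (zero_le _) _ Ha.
  + by right; exists x => //; exact: zero_le.
  + by right; exists x => //; exact: zero_le.
  + exact: tail_sub (zero_le _) _ Hb.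
- by move=> [x []] [] /=; [move=> _ /qQ|move=> /pP].
- move=> [x []] [y []] [a b] [/= Ha Hb] [/= Ha' Hb'].
  + by rewrite (QI _ _ _ Hb Hb').
  + by case: (PQI y x a b).
  + by case: (PQI x y a b).
  + by rewrite (PI _ _ _ Ha Ha').
(* A tail keeps its rank, and the other factor has rank one less: [IHn] serves the tail times [Q x],
   and [IHm] serves [P x] times the tail. *)
- move=> [x []]; rewrite /R /=.
    by rewrite addnS -addSn; apply: IHn; [exact: nstar_tail Ps PN|exact: QN].
  by apply: IHm; [exact: PN|exact: nstar_tail Qs QN].
(* Tails starting at [suc x] only leave pieces whose doubled index exceeds [dbl x i], whatever i
   is. *)
- move=> y; have [x [i ->]] := dbl_surj y.
  exists (tail p P (suc x), tail q Q (suc x)) => /=; first by split.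
  move=> [a b] [/= Ha Hb]; have [|[[z j] /= xz Rz]] := RE _ _ _ Ha Hb; first by left.
  right; exists (z, j) => //=; apply: ltW; rewrite dbl_lt.
  by rewrite -suc_le xz.
- move=> U [[V W] /= [/pU[xi xV] /qU[eta eW]] VW].
  exists (dbl (Order.max xi eta) false) => -[x i] /=; rewrite leNgt dbl_lt negb_or => /andP[].
  rewrite -leNgt ge_max => /andP[xix etax] _ [a b] Rab; apply: VW.
  have xS : x <= suc x by apply/ltW/suc_gt.
  case: i Rab => -[/= Ha Hb]; split; [apply: xV|apply: eW|apply: xV|apply: eW].
  + by apply: tail_sub Ha; exact: le_trans xS.
  + by right; exists x.
  + by right; exists x.
  + exact: tail_sub Hb.
Qed.

(** * Uniqueness of the iterated star of a given rank *)

Section Uniqueness.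

(** One half of a homeomorphism between A and B; the other half exchanges f and g. Continuity refers
    to the ambient spaces, which is harmless as the sets concerned are open. *)
Definition maps_onto (X Y : topologicalType) (A : set X) (B : set Y)
    (f : X -> Y) (g : Y -> X) :=
  forall x, A x -> [/\ B (f x), g (f x) = x & {for x, continuous f}].

(** The default q is the value at the centre, which lies in no piece. *)
Definition glue (X Y : Type) (p : X) (P : gamma -> set X) (q : Y)
    (f : gamma -> X -> Y) (x : X) : Y :=
  if pselect (exists xi, P xi x) is left h then f (sval (cid h)) x else q.

Lemma glueE X Y (p : X) (P : gamma -> set X) (q : Y) f xi x :
  (forall xi eta x, P xi x -> P eta x -> xi = eta) ->
  P xi x -> glue p P q f x = f xi x.
Proof.
move=> PI Px; rewrite /glue; case: pselect => [h|nh]; last by case: nh; exists xi.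
by case: (cid h) => eta Py /=; rewrite (PI _ _ _ Py Px).
Qed.

Lemma glue_center X Y (p : X) (P : gamma -> set X) (q : Y) f :
  (forall xi, ~ P xi p) -> glue p P q f p = q.
Proof.
move=> pP; rewrite /glue; case: pselect => // h.
by case: (cid h) => xi Px; case: (pP xi).
Qed.

(** Tails go to tails, whence continuity at the centre. Elsewhere the glued map agrees with some
    [f xi] near the point, since the pieces are open. *)
Lemma glue_maps (X Y : topologicalType) n (A : set X) (B : set Y) p P q Q f g :
  star p P A -> star q Q B -> (forall xi, nstar n (P xi)) ->
  (forall xi, maps_onto (P xi) (Q xi) (f xi) (g xi)) ->
  maps_onto A B (glue p P q f) (glue q Q p g).
Proof.
move=> [AE pP PI pN pU] [BE qQ QI qN qU] PN fg x.
have fE xi z : P xi z -> glue p P q f z = f xi z by exact: glueE.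
have gE xi z : Q xi z -> glue q Q p g z = g xi z by exact: glueE.
rewrite AE BE => /tail0P[->|[xi Px]].
  rewrite !glue_center//; split => //; first by left.
  move=> U; rewrite /= glue_center// => /qU[xi xU].
  apply: filterS (pN xi) => z [->|[eta xe Pz]] /=.
    by rewrite glue_center//; apply: xU; left.
  by apply: xU; right; exists eta => //; rewrite (fE _ _ Pz); case: (fg _ _ Pz).
have [Qf gf fc] := fg _ _ Px; rewrite (fE _ _ Px) (gE _ _ Qf); split => //.
  by right; exists xi => //; exact: zero_le.
move=> U; rewrite /= (fE _ _ Px) => /fc /= fU.
have xP := nstar_nbhs (PN xi) Px.
change (nbhs x (f xi @^-1` U)) in fU.
apply: filterS (filterI fU xP) => z [/= ? Pz].
by rewrite (fE _ _ Pz).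
Qed.

Lemma nstar_uniq (X Y : topologicalType) n (A : set X) (B : set Y) :
  nstar n A -> nstar n B -> exists f g, maps_onto A B f g /\ maps_onto B A g f.
Proof.
elim: n A B => [|n IH] A B.
  move=> [x -> _] [y -> _]; exists (fun=> y), (fun=> x).
  by split=> z ->; split => //; exact: cvg_cst.
move=> [p [P [Ps PN]]] [q [Q [Qs QN]]].
have /choice[h hP] : forall xi, exists h : (X -> Y) * (Y -> X),
    maps_onto (P xi) (Q xi) h.1 h.2 /\ maps_onto (Q xi) (P xi) h.2 h.1.
  by move=> xi; have [f [g fg]] := IH _ _ (PN xi) (QN xi); exists (f, g).
exists (glue p P q (fun xi => (h xi).1)), (glue q Q p (fun xi => (h xi).2)).
by split; [apply: (glue_maps Ps Qs PN)|apply: (glue_maps Qs Ps QN)] => xi; case: (hP xi).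
Qed.

Lemma nstar_homeomorphic (X Y : topologicalType) n :
  nstar n [set: X] -> nstar n [set: Y] -> homeomorphic X Y.
Proof.
move=> XN YN; have [f [g [fP gP]]] := nstar_uniq XN YN.
by exists f, g; split=> x; [case: (fP x)|case: (gP x)|case: (fP x)|case: (gP x)].
Qed.

End Uniqueness.
End Stars.

Arguments nstar {d} gamma {X} n A.

(** * The space L_gamma *)

Section OrderNbhs.
Context {d : Order.disp_t} {T : orderTopologicalType d}.
Implicit Types (x y l u : T) (U : set T).

Lemma nbhs_between x l u U : l < x -> x < u ->
  (forall y, l < y -> y < u -> U y) -> nbhs x U.
Proof.
move=> lx xu lU; apply: (@filterS _ _ _ `]l, u[%classic).
  by move=> y; rewrite /= in_itv /= => /andP[]; exact: lU.
by apply: open_nbhs_nbhs; split; [exact: itv_open|rewrite /= in_itv /= lx].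
Qed.

Lemma nbhs_below x u U : x < u -> (forall y, y < u -> U y) -> nbhs x U.
Proof.
move=> xu lU; apply: (@filterS _ _ _ `]-oo, u[%classic).
  by move=> y; rewrite /= in_itv /=; exact: lU.
by apply: open_nbhs_nbhs; split; [exact: lray_open|rewrite /= in_itv /=].
Qed.

Lemma nbhs_above x l U : l < x -> (forall y, l < y -> U y) -> nbhs x U.
Proof.
move=> lx lU; apply: (@filterS _ _ _ `]l, +oo[%classic).
  by move=> y; rewrite /= in_itv /= andbT; exact: lU.
by apply: open_nbhs_nbhs; split; [exact: rray_open|rewrite /= in_itv /= lx].
Qed.

(** Limit points are approached from below only in what follows, so the left half of a neighbourhood
    is enough. The point y serves as left end when the interval is unbounded below. *)
Lemma nbhs_left x y U : y < x -> nbhs x U ->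
  exists2 l, l < x & forall z, l < z -> z <= x -> U z.
Proof.
move=> yx; rewrite itv_nbhsE => -[[l u] [ends xi] iU].
case: l ends xi iU => [[] l|[]] ends; rewrite inE => xi iU.
- by case: u ends xi iU => [[] u|[]] //; rewrite itv_boundlr => _ /andP[].
- move: (xi) => /andP[lx xu]; exists l => // z lz zx; apply: iU.
  by apply/andP; split => //; apply: le_trans xu; rewrite bnd_simp.
- move: (xi) => /andP[_ xu]; exists y => // z lz zx; apply: iU.
  by apply/andP; split => //; apply: le_trans xu; rewrite bnd_simp.
- by case/andP: xi; rewrite bnd_simp.
Qed.
End OrderNbhs.

(** The zigzag order on the positive integers has the order type of the integers: even numbers go up
    by two, odd numbers come down by two, and 1 is followed by 2. *)
Lemma zigzag_next m : exists m', zigzag_lt m.+1 m'.+1 /\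
  forall n, ~~ (zigzag_lt m.+1 n.+1 && zigzag_lt n.+1 m'.+1).
Proof.
exists (if odd m then m.+2 else if m is m'.+2 then m' else 1%N).
rewrite /zigzag_lt; case: (boolP (odd m)) => om.
  split=> [|n]; rewrite /= om /=; first by lia.
  by case: (boolP (odd n)) => on //=; lia.
case: m om => [|[|m]] //= om; split=> [|n] //=.
- by case: (boolP (odd n)) => on //=; lia.
- by move: (om); rewrite negbK => /negbTE -> /=; lia.
- by move: (om); rewrite negbK => /negbTE -> /=; case: (boolP (odd n)) => on //=; lia.
Qed.

Lemma zigzag_prev m : exists m', zigzag_lt m'.+1 m.+1 /\
  forall n, ~~ (zigzag_lt m'.+1 n.+1 && zigzag_lt n.+1 m.+1).
Proof.
exists (if odd m then (if m is m'.+2 then m' else 0%N) else m.+2).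
rewrite /zigzag_lt; case: (boolP (odd m)) => om; last first.
  split=> [|n]; rewrite /= (negbTE om) /=; first by lia.
  by case: (boolP (odd n)) => on //=; lia.
case: m om => [|[|m]] //= om; split=> [|n] //=.
- by case: (boolP (odd n)) => on //=; lia.
- by move: (om); rewrite negbK => -> /=; lia.
- by move: (om); rewrite negbK => -> /=; case: (boolP (odd n)) => on //=; lia.
Qed.

(** * The points of L_gamma and their order *)

Section LambdaPoints.
Context {d : Order.disp_t} {gamma : infiniteCardinalType d}.
Implicit Types (a b l : gamma) (x y : lambda gamma).

Definition pt a b : lambda gamma := Some (a, b).

Lemma pt_lt a b a' b' :
  (pt a b < pt a' b') = (a < a') || ((a == a') && (b < b')).
Proof.
rewrite -[LHS]/(((a, b) : gamma *l gamma) < (a', b')) ltEprodlexi /=.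
by case: (ltgtP a a').
Qed.

Lemma pt_le a b a' b' :
  (pt a b <= pt a' b') = (a < a') || ((a == a') && (b <= b')).
Proof. by rewrite leNgt pt_lt leNgt; case: (ltgtP a a'). Qed.

Lemma pt_lt_max a b : pt a b < max_lambda gamma.
Proof. by []. Qed.

Lemma pt_inj a b a' b' : pt a b = pt a' b' -> a = a' /\ b = b'.
Proof. by case. Qed.

Lemma lambda_lt_max x : (x < max_lambda gamma) = (x != max_lambda gamma).
Proof. by case: x. Qed.

Lemma osucc_pt a b : osucc (pt a b) = pt a (suc b).
Proof.
have [lt_s le_s] := @osuccP d gamma (pt a b) isT.
apply/le_anti; rewrite le_s ?pt_lt ?eqxx ?suc_gt ?orbT//=.
move: lt_s; case: (osucc _) => [[a' b']|] //.
rewrite -/(pt a' b') pt_lt pt_le; case: ltgtP => //= _.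
by rewrite suc_le.
Qed.

Lemma oadd_pt a b n : oadd (pt a b) n = pt a (iter n suc b).
Proof. by rewrite /oadd; elim: n => //= n ->; rewrite osucc_pt. Qed.

Lemma isolated_nbhs x : isolated [set: lambda gamma] x <-> nbhs x [set x].
Proof.
split=> [[_ [U Ux]]|nx]; first by rewrite setIT => <-.
by split; [rewrite inE|exists [set x]; rewrite ?setIT].
Qed.

Lemma isolated_left x y : isolated [set: lambda gamma] x -> y < x ->
  exists2 z, z < x & forall t, z < t -> x <= t.
Proof.
move=> /isolated_nbhs nx yx; have [z zx zU] := nbhs_left yx nx.
exists z => // t zt; rewrite leNgt; apply/negP => tx.
by have := zU t zt (ltW tx) => /= e; rewrite e ltxx in tx.
Qed.

Lemma Lset_suc a b : Lset gamma (pt a (suc b)).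
Proof. by constructor 3; rewrite -osucc_pt; exact: osucc_isolated. Qed.

Lemma Lset_zero : Lset gamma (pt zero zero).
Proof.
constructor 3; apply/isolated_nbhs.
apply: (@nbhs_below _ _ _ (pt zero (suc zero))); first by rewrite pt_lt eqxx suc_gt orbT.
move=> [[a b]|//]; rewrite -/(pt a b) pt_lt lt_zero lt_suc /= => /andP[/eqP -> b0].
have -> // : b = zero by apply/le_anti; rewrite b0 zero_le.
Qed.

(** The column {a} x gamma followed by this point is a copy of gamma + 1. *)
Lemma Lset_lim a : Lset gamma (pt (suc a) zero).
Proof.
constructor 2; exists (pt a zero); first by rewrite pt_lt suc_gt.
exists (oapp (pt a) (pt (suc a) zero)).
  have aN b : (pt (suc a) zero <= pt a b) = false by rewrite leNgt pt_lt suc_gt.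
  have aP b : pt a b <= pt (suc a) zero by rewrite pt_le suc_gt.
  move=> [b|] [b'|] /=; rewrite ?aN ?aP ?lexx //.
  by rewrite !leNgt pt_lt ltxx eqxx.
apply/seteqP; split=> [_ [[b|] _ <-] /=|].
- by rewrite !pt_le ltxx eqxx suc_gt zero_le.
- by rewrite !pt_le suc_gt ltxx eqxx zero_le.
move=> [[a' b']|] /=; last by rewrite leNgt.
rewrite -!/(pt a' b') !pt_le.
move=> /andP[/orP[aa'|/andP[/eqP <- _]] h]; last by exists (Some b').
exists None => //=; case/orP: h => [|/andP[/eqP -> b0]].
  by rewrite lt_suc leNgt aa'.
have -> // : b' = zero by apply/le_anti; rewrite b0 zero_le.
Qed.


(* If [(a, b), x] is isomorphic to gamma + 1 then x cannot be of the form (a, c),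
   nor above some (a', 0) with a < a', as gamma would be embedded below c in the
   first case, and the tail of {a} x gamma below a point in the second. *)
Lemma gamma_limitE x : gamma_limit x -> exists a, x = pt (suc a) zero.
Proof.
move=> [[[a b]|//] ax [f fmono frange]]; exists a.
rewrite -/(pt a b) in ax frange *.
have fN : f None = x.
  have [u _ fu] : range f x by rewrite frange /= lexx (ltW ax).
  have [_ fNx] : pt a b <= f None /\ f None <= x.
    by apply/andP; have : range f (f None) by []; rewrite frange.
  have xfN : x <= f None by rewrite -fu fmono leNgt.
  by apply/le_anti; rewrite fNx xfN.
have f_inj : injective f by move=> u v e; apply/le_anti; rewrite -!fmono e lexx.
have fltE u v : (f u < f v) = (u < v) by rewrite !ltNge fmono.
have fS z : pt a b <= z -> z < x -> exists c, f (Some c) = z.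
  move=> az zx; have [[c|] _ fu] : range f z by rewrite frange /= az ltW.
    by exists c.
  by move: zx; rewrite -fu fN ltxx.
have below a' : a < a' -> x <= pt a' zero.
  move=> aa'; rewrite leNgt; apply/negP => a'x.
  have [c fc] : exists c, f (Some c) = pt a' zero.
    by apply: fS => //; rewrite pt_le aa'.
  have [t [tmono tge _]] := tail_iso b.
  have /choice[g gP] : forall y : gamma, exists c', f (Some c') = pt a (t y).
    move=> y; apply: fS; first by rewrite pt_le eqxx tge orbT.
    by apply: lt_trans a'x; rewrite pt_lt aa'.
  apply: (@card_no_embedding _ _ g c).
    move=> y y' e; have [_ te] : a = a /\ t y = t y'.
      by apply: pt_inj; rewrite -!gP e.
    by case: (ltgtP y y') => //; rewrite -tmono te ltxx.
  move=> y; rewrite -[_ < _]/((Some (g y) : adjoin_top gamma) < Some c).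
  by rewrite -fltE gP fc pt_lt aa'.
have outside c : x <> pt a c.
  move=> xc.
  have /choice[g gP] : forall y : gamma, exists c', f (Some y) = pt a c'.
    move=> y; have : range f (f (Some y)) by [].
    have : f (Some y) < x by rewrite -fN fltE.
    rewrite frange xc; case: (f _) => [[a' b']|] //.
    rewrite /= -!/(pt _ _) !(pt_le, pt_lt) => h /andP[h1 h2]; exists b'.
    by case: (ltgtP a a') h h1 h2 => //= -> .
  apply: (@card_no_embedding _ _ g c).
    by move=> y y' e; have /f_inj[] : f (Some y) = f (Some y') by rewrite !gP e.
  move=> y; have : f (Some y) < x by rewrite -fN fltE.
  by rewrite gP xc pt_lt ltxx eqxx.
have := below _ (suc_gt a); move: ax outside {fN fS frange below}.
case: x => [[a1 b1]|//]; rewrite -!/(pt _ _) pt_lt pt_le => ax out.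
case: (ltgtP a a1) ax => [aa1 _|//|e]; last by case: (out b1); rewrite e.
rewrite lt_suc leNgt aa1 /= => /andP[/eqP -> b1z].
by have -> : b1 = zero by apply/le_anti; rewrite b1z zero_le.
Qed.


(** If the point were isolated it would have a predecessor z. But (a, zero) lies strictly between if
    z is in an earlier column, and (a, suc b) does if z = (a, b), as l is a limit. *)
Lemma nLset_lim a l : islim l -> zero < l -> ~ Lset gamma (pt a l).
Proof.
move=> ll l0 [//|/gamma_limitE[a' /pt_inj[_ l00]]|al].
  by rewrite l00 ltxx in l0.
have [|z] := isolated_left al (_ : pt a zero < _).
  by rewrite pt_lt eqxx l0 orbT.
case: z => [[a' b]|//]; rewrite -/(pt a' b) pt_lt => /orP[a'a|/andP[/eqP -> bl]] h.
  have := h (pt a zero); rewrite pt_lt pt_le a'a ltxx eqxx leNgt l0.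
  by move=> /(_ isT).
have := h (pt a (suc b)); rewrite pt_lt pt_le ltxx eqxx suc_gt leNgt lim_suc// bl.
by move=> /(_ isT).
Qed.

(** A predecessor would lie in a column a' < a, and (suc a', zero) would lie strictly between. *)
Lemma nLset_lim0 a : islim a -> zero < a -> ~ Lset gamma (pt a zero).
Proof.
move=> la a0 [//|/gamma_limitE[a' /pt_inj[aa' _]]|al].
  by case: (la a').
have [|z] := isolated_left al (_ : pt zero zero < _).
  by rewrite pt_lt a0.
case: z => [[a' b]|//]; rewrite -/(pt a' b) pt_lt lt_zero andbF orbF => a'a h.
have := h (pt (suc a') zero); rewrite pt_lt pt_le suc_gt lt_suc leNgt a'a /=.
by move=> /(_ isT)/andP[/eqP aa' _]; case: (la a').
Qed.

Lemma not_lim b : ~ islim b -> exists b', b = suc b'.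
Proof. by move=> /existsNP[b' /contrapT <-]; exists b'. Qed.

(** By the lemmas above these are all the points of L_gamma. The points [Iso a b] of column a
    converge to [Lim a], and the columns converge to [Top]. *)
Inductive code := Bot | Top | Iso of gamma & gamma | Lim of gamma.

Definition code_pt (z : code) : lambda gamma :=
  match z with
  | Bot => pt zero zero
  | Top => max_lambda gamma
  | Iso a b => pt a (suc b)
  | Lim a => pt (suc a) zero
  end.

Lemma code_Lset z : Lset gamma (code_pt z).
Proof.
case: z => [||a b|a]; [exact: Lset_zero|by constructor 1|exact: Lset_suc|exact: Lset_lim].
Qed.

Lemma Lset_code x : Lset gamma x -> exists z, code_pt z = x.
Proof.
case: x => [[a b]|]; last by exists Top.
rewrite -/(pt a b) => Lab.
have [lb|/not_lim[b' ->]] := pselect (islim b); last by exists (Iso a b').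
have b0 : b = zero.
  by apply/eqP; rewrite eq_le zero_le andbT leNgt; apply/negP => b0; exact: nLset_lim lb b0 Lab.
rewrite {}b0 {b lb} in Lab *.
have [la|/not_lim[a' ->]] := pselect (islim a); last by exists (Lim a').
suff -> : a = zero by exists Bot.
by apply/eqP; rewrite eq_le zero_le andbT leNgt; apply/negP => a0; exact: nLset_lim0 la a0 Lab.
Qed.

Lemma code_pt_inj : injective code_pt.
Proof.
move=> [||a b|a] [||a' b'|a'] //= /pt_inj[].
- by move=> _ h; case: (@zero_lim _ gamma b').
- by move=> h; case: (@zero_lim _ gamma a').
- by move=> _ h; case: (@zero_lim _ gamma b).
- by move=> -> /suc_inj ->.
- by move=> _ h; case: (@zero_lim _ gamma b).
- by move=> h; case: (@zero_lim _ gamma a).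
- by move=> _ h; case: (@zero_lim _ gamma b').
- by move=> /suc_inj ->.
Qed.

Definition code_L (z : code) : set_type (Lset gamma) := SigSub (mem_set (code_Lset z)).

Lemma code_L_inj : injective code_L.
Proof. by move=> z w /(congr1 val) /= /code_pt_inj. Qed.

Lemma code_L_surj u : exists z, code_L z = u.
Proof. by have [z zu] := Lset_code (set_valP u); exists z; apply: val_inj. Qed.

(* If alpha = (a, l) is not in L_gamma then l is a limit or 0, and R_alpha consists
   of the points (a, b + 1) such that b = l + n for some natural number n. *)
Definition zigzag_block a l : Prop := ~ Lset gamma (pt a l).

Definition prec_code (z w : code) : Prop := prec (code_L z) (code_L w).

Lemma Rblock_code al z : ~ Lset gamma al -> Rblock al (code_pt z) ->
  exists a b, [/\ z = Iso a b, al = pt a (lpart b) & code_pt z = oadd al (npart b).+1].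
Proof.
case: al => [[a l]|]; last by move=> h; case: h; constructor 1.
rewrite -/(pt a l) => nL [n n0]; rewrite oadd_pt => e.
have ll : islim l by move=> l' ll'; apply: nL; rewrite -ll'; exact: Lset_suc.
case: n n0 e => // n _ e; exists a, (iter n suc l).
have -> : z = Iso a (iter n suc l) by apply: code_pt_inj.
by rewrite lpart_iter// npart_iter// oadd_pt; split.
Qed.

Definition same_block (z w : code) :=
  exists al, [/\ ~ Lset gamma al, Rblock al (code_pt z) & Rblock al (code_pt w)].

Lemma Rblock_Iso a b : Rblock (pt a (lpart b)) (code_pt (Iso a b)).
Proof. by exists (npart b).+1 => //; rewrite oadd_pt iterS lnpartK. Qed.

(** Makes the case distinction in [prec] harmless: for gamma = omega the only limit is zero, so
    there are no blocks to reorder. *)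
Lemma no_block : countable [set: gamma] -> forall x, Lset gamma x.
Proof.
move=> cg [[a b]|]; last by constructor 1.
have [lb|/not_lim[b' ->]] := pselect (islim b); last exact: Lset_suc.
rewrite (countable_lim cg lb).
have [la|/not_lim[a' ->]] := pselect (islim a); last exact: Lset_lim.
by rewrite (countable_lim cg la); exact: Lset_zero.
Qed.

Lemma prec_out z w : ~ same_block z w -> prec_code z w <-> code_pt z < code_pt w.
Proof.
move=> nzw; rewrite /prec_code /prec; case: ifP => // _; split=> /=.
  by move=> [[al [nL Rz Rw _]]|[]//]; case: nzw; exists al.
by move=> zw; right; split=> // al nL [Rz Rw]; apply: nzw; exists al.
Qed.

Lemma same_block_Iso z w : same_block z w -> exists a b b',
  [/\ z = Iso a b, w = Iso a b', lpart b = lpart b' & zigzag_block a (lpart b)].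
Proof.
move=> [al [nL Rz Rw]]; have [a [b [-> e _]]] := Rblock_code nL Rz.
have [a' [b' [-> e' _]]] := Rblock_code nL Rw.
have [<- ll] := pt_inj (etrans (esym e) e').
by exists a, b, b'; split => //; rewrite /zigzag_block -e.
Qed.

(** Compares [Iso a (l + m)] with [Iso a (l + n)] for l a limit or zero; these points have the
    numbers m + 1 and n + 1 after (a, l). *)
Definition block_lt a l m n :=
  if `[< zigzag_block a l >] then zigzag_lt m.+1 n.+1 else (m < n)%N.

Definition code_lt (z w : code) : bool :=
  match z, w with
  | _, Bot => false
  | Bot, _ => true
  | Top, _ => false
  | _, Top => true
  | Lim a, Lim a' => a < a'
  | Lim a, Iso a' _ => a < a'
  | Iso a _, Lim a' => a <= a'
  | Iso a b, Iso a' b' => (a < a') || ((a == a') && ((lpart b < lpart b') ||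
      ((lpart b == lpart b') && block_lt a (lpart b) (npart b) (npart b'))))
  end.

Lemma prec_in a b b' : zigzag_block a (lpart b) -> lpart b = lpart b' ->
  prec_code (Iso a b) (Iso a b') <-> zigzag_lt (npart b).+1 (npart b').+1.
Proof.
move=> nL e; rewrite /prec_code /prec; case: ifP => [/asboolP cg|_].
  by case: (nL (no_block cg _)).
have Rb := Rblock_Iso a b; have Rb' := Rblock_Iso a b'; rewrite -e in Rb'.
have oaddE c : lpart c = lpart b ->
    code_pt (Iso a c) = oadd (pt a (lpart b)) (npart c).+1.
  by move=> <-; rewrite oadd_pt iterS lnpartK.
split=> [[[al [nal Rz _ [m [n [m0 n0 em en zz]]]]]|[/(_ _ nL) []//]]|zz].
  have ea := Rblock_inj nal nL Rz Rb; rewrite {}ea in em en.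
  have -> : (npart b).+1 = m by apply: (oadd_inj nL); rewrite -oaddE.
  by have -> : (npart b').+1 = n by apply: (oadd_inj nL); rewrite -oaddE.
left; exists (pt a (lpart b)); split=> //.
by exists (npart b).+1, (npart b').+1; split => //; exact: oaddE.
Qed.

Lemma prec_codeE z w : prec_code z w <-> code_lt z w.
Proof.
have [|ns] := pselect (same_block z w).
  move=> /same_block_Iso[a [b [b' [-> -> e zz]]]]; rewrite prec_in//=.
  by rewrite ltxx eqxx e ltxx eqxx /block_lt -e asboolT.
rewrite prec_out//; case: z w ns => [||a b|a] [||a' b'|a'] ns //=;
  rewrite ?pt_lt_max ?lambda_lt_max// ?pt_lt ?ltxx ?lt_zero ?suc_gt0 ?andbF ?andbT ?orbF//.
- by split=> // _; case: (ltgtP zero a') (zero_le a').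
(* In a zigzag block, equal columns and equal limit parts would put both points in the same block,
   which is excluded here. *)
- rewrite suc_ltE (lnpart_lt b) /block_lt; case: asboolP => // zz.
  suff : ~~ ((a == a') && (lpart b == lpart b')).
    by case: (a == a'); case: (lpart b == lpart b').
  apply/negP => /andP[/eqP aa' /eqP bb']; apply: ns.
  rewrite -{}aa' {a'}; exists (pt a (lpart b)); split=> //; first exact: Rblock_Iso.
  by rewrite bb'; exact: Rblock_Iso.
- by rewrite lt_suc.
- by rewrite orbC -le_eqVlt suc_le.
- by rewrite suc_ltE.
Qed.

(** * Immediate neighbours and cofinality for [prec] *)

Lemma block_lt_next a l m : exists m', block_lt a l m m' /\
  forall n, ~~ (block_lt a l m n && block_lt a l n m').
Proof.
rewrite /block_lt; case: asboolP => _; first exact: zigzag_next.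
by exists m.+1; split=> [|n]; lia.
Qed.

Lemma block_lt_prev a l m : zigzag_block a l \/ (0 < m)%N ->
  exists m', block_lt a l m' m /\ forall n, ~~ (block_lt a l m' n && block_lt a l n m).
Proof.
rewrite /block_lt; case: asboolP => [_ _|nz [//|m0]]; first exact: zigzag_prev.
by exists m.-1; split=> [|n]; lia.
Qed.

Definition gap z w := code_lt z w /\ forall v, code_lt z v -> code_lt v w -> False.

Lemma gap_Iso a l m n : islim l -> block_lt a l m n ->
    (forall k, ~~ (block_lt a l m k && block_lt a l k n)) ->
  gap (Iso a (iter m suc l)) (Iso a (iter n suc l)).
Proof.
move=> ll mn nk; split=> /=; first by rewrite !lpart_iter// !npart_iter// mn !eqxx ?orbT.
move=> [||a' b|a'] //=; last by rewrite leNgt => /negP aa' /aa'.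
rewrite !lpart_iter// !npart_iter//.
case: (ltgtP a a') => //= <-; case: (ltgtP l (lpart b)) => //= <- h1 h2.
by have := nk (npart b); rewrite h1 h2.
Qed.

Lemma zigzag_blockP a l : islim l -> ~ zigzag_block a l ->
  l = zero /\ (a = zero \/ exists a', a = suc a').
Proof.
move=> ll /contrapT /Lset_code[[||a' b'|a']] //= /pt_inj[].
- by move=> <- <-; split => //; left.
- by move=> _ h; case: (ll b').
- by move=> <- <-; split => //; right; exists a'.
Qed.

(** In these cases z is (a, 0) itself. As it lies in L_gamma, the points after it keep their usual
    order, and (a, 1) comes next. *)
Lemma gap_Iso_zero z a : (z = Bot /\ a = zero) \/ (exists2 a', z = Lim a' & a = suc a') ->
  gap z (Iso a zero).
Proof.
have nzz : a = zero \/ (exists a', a = suc a') -> ~ zigzag_block a zero.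
  move=> [->|[a' ->]] h; apply: h; [exact: Lset_zero|exact: Lset_lim].
have lz0 : lpart zero = zero :> gamma by exact: (@lpart_iter _ gamma zero 0 (@zero_lim _ _)).
have nz0 : npart (zero : gamma) = 0%N by exact: (@npart_iter _ gamma zero 0 (@zero_lim _ _)).
have noIso b : ~ zigzag_block a zero -> code_lt (Iso a b) (Iso a zero) -> False.
  move=> nz /=; rewrite lz0 nz0 ltxx eqxx lt_zero /= => /andP[/eqP ->].
  by rewrite /block_lt asboolF.
move=> [[-> a0]|[a1 -> ea]]; split=> //.
- move=> [||a' b|a'] //; last by rewrite /= a0 lt_zero.
  move=> _ h; have aa' : a' = a by move: h => /=; rewrite a0 lt_zero /= => /andP[/eqP].
  by rewrite aa' in h; apply: noIso h; apply: nzz; left.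
- by rewrite /= ea suc_gt.
- move=> [||a' b|a'] //; last first.
    by rewrite /= ea lt_suc leNgt => h /negP.
  move=> h1 h; have aa' : a' = a.
    move: h h1 => /=; case: (ltgtP a' a) => //; rewrite ea lt_suc leNgt.
    by move=> /negP.
  by rewrite aa' in h; apply: noIso h; apply: nzz; right; exists a1.
Qed.

Lemma gap_right z : z <> Top -> exists w, gap z w.
Proof.
case: z => [_|//|a b _|a _].
- by exists (Iso zero zero); apply: gap_Iso_zero; left.
- have [m' [h1 h2]] := block_lt_next a (lpart b) (npart b).
  exists (Iso a (iter m' suc (lpart b))); rewrite -{1}(lnpartK b).
  exact: (gap_Iso (@lpart_lim _ _ b) h1 h2).
- by exists (Iso (suc a) zero); apply: gap_Iso_zero; right; exists a.
Qed.

(** This is what the zigzag achieves: the first point after a removed limit gets a predecessor. A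
    block in the usual order starts right after some (a, 0) in L_gamma, which precedes its first
    point. *)
Lemma gap_left a b : exists w, gap w (Iso a b).
Proof.
have [zz|] := pselect (zigzag_block a (lpart b) \/ (0 < npart b)%N).
  have [m' [h1 h2]] := block_lt_prev zz.
  exists (Iso a (iter m' suc (lpart b))); rewrite -{2}(lnpartK b).
  exact: (gap_Iso (@lpart_lim _ _ b) h1 h2).
move=> /not_orP[/(zigzag_blockP (@lpart_lim _ _ b))[lb ha] nb].
have -> : b = zero by rewrite -[b]lnpartK lb; case: (npart b) nb.
case: ha => [a0|[a' ea]].
  by exists Bot; apply: gap_Iso_zero; left.
by exists (Lim a'); apply: gap_Iso_zero; right; exists a'.
Qed.

(** Together with [Iso_cofinal]: within a column, the tails for [prec] and those for the usual order
    are mutually cofinal, so both give the same convergence to [Lim a]. *)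
Lemma Iso_tail a b : exists b1, forall b', code_lt (Iso a b1) (Iso a b') -> b <= b'.
Proof.
(* The number of [Iso a b] in its block is [(npart b).+1]. The witness is chosen to have an even
   number, since in the zigzag only larger numbers follow an even one. *)
exists (if odd (npart b) then b else suc b) => b' /=.
rewrite ltxx eqxx /= => /orP[h|/andP[/eqP e]].
  by rewrite ltW// lnpart_lt; move: h; case: ifP => _; rewrite ?lpart_suc => ->.
rewrite leNgt; apply: contraL => h; move: h e; rewrite lnpart_lt.
case: ifP => ob; rewrite ?lpart_suc ?npart_suc => h e.
all: move: h; rewrite e ltxx eqxx /= /block_lt => h; case: asboolP => _; rewrite /zigzag_lt /= ?ob /=;
  try case: ifP; lia.
Qed.

Lemma Iso_cofinal a b : exists b1, forall b', b1 <= b' -> code_lt (Iso a b) (Iso a b').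
Proof.
have [zz|nzz] := pselect (zigzag_block a (lpart b)).
  (* If the number of b is odd, smaller odd numbers follow it, so the whole block is skipped by
     passing to a limit above b. Such a limit exists since a zigzag block forces gamma to be
     uncountable. *)
  have [|l ll bl] := @uncountable_lim _ gamma b; first by move=> cg; exact/zz/no_block.
  exists l => b' lb' /=; rewrite ltxx eqxx /=.
  suff -> : lpart b < lpart b' by [].
  have h : lpart b < l by rewrite -[b]lnpartK lim_iter in bl.
  apply: lt_le_trans h _; rewrite leNgt; apply/negP => h'.
  by rewrite -(lim_iter _ (npart b') ll) lnpartK ltNge lb' in h'.
exists (suc b) => b'; rewrite suc_le lnpart_lt /= ltxx eqxx /=.
by rewrite /block_lt asboolF.
Qed.

Lemma Lim_cofinal z a : code_lt z (Lim a) ->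
  exists b1, forall b, b1 <= b -> code_lt z (Iso a b).
Proof.
case: z => [||a' b|a'] //= h; [by exists zero| |by exists zero].
move: h; rewrite le_eqVlt => /orP[/eqP ->|h]; last by exists zero => b' _; rewrite h.
exact: Iso_cofinal.
Qed.

Lemma Top_cofinal z : code_lt z Top ->
  exists a1, forall a, a1 <= a -> code_lt z (Lim a) /\ forall b, code_lt z (Iso a b).
Proof.
case: z => [||a' b'|a'] //= _; first by exists zero.
- by exists (suc a') => a; rewrite suc_le => h; split=> [|b]; rewrite ?h ?ltW.
- by exists (suc a') => a; rewrite suc_le => h; split=> [|b]; rewrite ?h ?ltW.
Qed.

Lemma code_lt_total z w : [\/ z = w, code_lt z w | code_lt w z].
Proof.
have [->|zw] := pselect (z = w); first by constructor 1.
have [||h] := @prec_total _ gamma (code_L z) (code_L w).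
- by move=> /code_L_inj.
- by move=> /prec_codeE; constructor 2.
- by constructor 3; apply/prec_codeE.
Qed.

Lemma code_lt_irr z : code_lt z z = false.
Proof. by apply/negP => /prec_codeE /prec_irr. Qed.

Lemma code_lt_trans z w v : code_lt z w -> code_lt w v -> code_lt z v.
Proof. by move=> /prec_codeE h1 /prec_codeE h2; apply/prec_codeE; exact: prec_trans h2. Qed.

Lemma gap_eq w1 z w2 v : gap w1 z -> gap z w2 -> code_lt w1 v -> code_lt v w2 -> v = z.
Proof.
move=> [_ g1] [_ g2] h1 h2; case: (code_lt_total v z) => // h.
  by case: (g1 v).
by case: (g2 v).
Qed.

End LambdaPoints.

Arguments code {d} gamma.

(** * L_gamma as an iterated star of rank two *)

Section TwoLevels.
Context {d : Order.disp_t} {gamma : infiniteCardinalType d}.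
Implicit Types (a b : gamma) (z : code gamma).

Definition lim_nbhd a b : set (code gamma) :=
  [set z | z = Lim a \/ exists2 b', b <= b' & z = Iso a b'].

Definition top_nbhd a : set (code gamma) :=
  [set z | z = Top \/ exists2 a', a <= a' & lim_nbhd a' zero z].

(** Shared by L_gamma and by the rows of the square. [Bot] is left out because the first point of a
    row need not be isolated. *)
Lemma nstar2_code (X : topologicalType) (c : code gamma -> X) : injective c ->
    (forall a b, nbhs (c (Iso a b)) [set c (Iso a b)]) ->
    (forall a b, nbhs (c (Lim a)) (c @` lim_nbhd a b)) ->
    (forall a U, nbhs (c (Lim a)) U -> exists b, c @` lim_nbhd a b `<=` U) ->
    (forall a, nbhs (c Top) (c @` top_nbhd a)) ->
    (forall U, nbhs (c Top) U -> exists a, c @` top_nbhd a `<=` U) ->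
  nstar gamma 2 (c @` [set z | z <> Bot]).
Proof.
move=> c_inj nI nL uL nT uT.
have tailL a b : tail (c (Lim a)) (fun b => [set c (Iso a b)]) b = c @` lim_nbhd a b.
  apply/seteqP; split=> x.
    by move=> [->|[b' bb' ->]]; [exists (Lim a)|exists (Iso a b')] => //; [left|right; exists b'].
  by move=> [z [->|[b' bb' ->]] <-]; [left|right; exists b'].
exists (c Top), (fun a => c @` lim_nbhd a zero); split; last first.
  move=> a; exists (c (Lim a)), (fun b => [set c (Iso a b)]); split; last first.
    by move=> b; exists (c (Iso a b)).
  split.
  - by rewrite tailL.
  - by move=> b /c_inj.
  - by move=> b b' x -> /c_inj[].
  - by move=> b; rewrite tailL.
  - by move=> U /uL[b bU]; exists b; rewrite tailL.
have tailT a : tail (c Top) (fun a => c @` lim_nbhd a zero) a = c @` top_nbhd a.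
  apply/seteqP; split=> x.
    move=> [->|[a' aa' [z z1 <-]]]; first by exists Top => //; left.
    by exists z => //; right; exists a'.
  move=> [z [->|[a' aa' z1]] <-]; [by left|right].
  by exists a' => //; exists z.
split.
- rewrite tailT; congr (c @` _); apply/seteqP; split=> z /=.
    case: z => [//||a b|a] _; [by left|right|right]; exists a; rewrite ?zero_le//.
      by right; exists b; rewrite ?zero_le.
    by left.
  by move=> [->//|[a _ [->//|[b _ ->//]]]].
- by move=> a [z [->|[b _ ->]] /c_inj].
- by move=> a a' _ [z [->|[b _ ->]] <-] [w [->|[b' _ ->]] /c_inj[]].
- by move=> a; rewrite tailT.
- by move=> U /uT[b bU]; exists b; rewrite tailT.
Qed.

Lemma nbhs_val (T : topologicalType) (A : set T) (u : set_type A) (U : set (set_type A)) :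
  nbhs u U <-> exists2 V, nbhs (val u) V & forall v, V (val v) -> U v.
Proof.
split=> [|[V Vu VU]].
  move=> Uu; have : exists2 B, open_nbhs u B & B `<=` U by move: Uu; rewrite nbhsE.
  move=> [_ [[V oV <-] Vu] WU]; exists V => //.
  by apply: open_nbhs_nbhs; split.
move: Vu; rewrite nbhsE => -[W [oW Wu] WV]; rewrite nbhsE; exists (val @^-1` W).
  by split => //; exists W.
by move=> v /WV/VU.
Qed.

Lemma nstar2_Lset : nstar gamma 2 [set: set_type (Lset gamma)].
Proof.
have isoN z : isolated [set: lambda gamma] (code_pt z) ->
    nbhs (code_L z) [set code_L z].
  move=> /isolated_nbhs nz; apply/nbhs_val; exists [set code_pt z] => //.
  by move=> v vz; exact: val_inj.
have -> : [set: set_type (Lset gamma)] =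
    code_L @` [set z | z <> Bot] `|` [set code_L Bot].
  apply/seteqP; split=> // u _; have [z <-] := code_L_surj u.
  by case: z => [||a b|a]; [right|left; exists Top|left; exists (Iso a b)|
    left; exists (Lim a)].
apply: (@nstar_absorb _ _ _ 0) => //; last first.
- by apply/seteqP; split=> // u [[z z0 <-] /code_L_inj].
- apply: nstar2_code; first exact: code_L_inj.
  + by move=> a b; apply: isoN; rewrite /= -osucc_pt; exact: osucc_isolated.
  (* [Iso a b'] is the point (a, b' + 1), so it is above (a, b) exactly when b <= b'. *)
  + move=> a b; apply/nbhs_val; exists `]pt a b, pt (suc a) (suc zero)[%classic.
      apply: open_nbhs_nbhs; split; first exact: itv_open.
      by rewrite /= in_itv /= !pt_lt suc_gt eqxx suc_gt0 orbT.
    move=> v; have [z <-] := code_L_surj v; rewrite /= in_itv /= => zab.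
    exists z => //; move: zab; case: z => [||a' b'|a'] /=; rewrite ?lt_zero ?andbF//.
    * by rewrite pt_lt !lt_zero andbF.
    * rewrite !pt_lt ![_ < suc _]lt_suc; case: (ltgtP a a') => //= [aa'|<-].
        by rewrite suc_le lt_zero andbF.
      by move=> /andP[bb' _]; right; exists b'.
    * rewrite !pt_lt !lt_zero !andbF !orbF suc_ltE lt_suc (inj_eq suc_inj).
      by case: (ltgtP a a') => //= <-; left.
  + move=> a U /nbhs_val[V Va VU].
    have [|[[a' b']|//]] := @nbhs_left _ _ _ (pt a zero) _ _ Va.
      by rewrite /= pt_lt suc_gt.
    rewrite -/(pt a' b') pt_lt lt_zero andbF orbF lt_suc => aa' lV.
    (* If the left end lies in an earlier column, all of column a is in the neighbourhood. *)
    exists (if a' == a then b' else zero) => u [z zN <-]; apply: VU.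
    apply: lV; case: zN => [->|[b bb' ->]] /=.
    * by rewrite pt_lt lt_zero andbF orbF lt_suc.
    * rewrite pt_lt; move: aa' bb'; case: (ltgtP a' a) => //= _ _.
      by rewrite lt_suc.
    * by rewrite lexx.
    * by rewrite pt_le suc_gt.
  + move=> a; apply/nbhs_val; exists `]pt a zero, +oo[%classic.
      by apply: open_nbhs_nbhs; split; [exact: rray_open|rewrite /= in_itv].
    move=> v; have [z <-] := code_L_surj v; rewrite /= in_itv /= andbT => za.
    exists z => //; move: za; case: z => [||a' b'|a'] /=.
    * by rewrite pt_lt !lt_zero andbF.
    * by left.
    * rewrite pt_lt suc_gt0 andbT orbC -le_eqVlt => aa'.
      by right; exists a' => //; right; exists b'; rewrite ?zero_le.
    * rewrite pt_lt lt_zero andbF orbF lt_suc => aa'.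
      by right; exists a' => //; left.
  + move=> U /nbhs_val[V Vt VU].
    have [|[[a' b']|//] _ lV] := @nbhs_left _ _ _ (pt zero zero) _ _ Vt => //.
    exists (suc a') => _ [z zN <-]; apply: VU; apply: lV; last exact: le_max_lambda.
    case: zN => [->//|[a aa' [->|[b _ ->]]]]; rewrite -/(pt a' b') /= pt_lt.
    * by rewrite lt_suc ltW -?suc_le.
    * by rewrite -suc_le aa'.
- exists (code_L Bot) => //; apply: isoN; rewrite /=.
  (* Of the clauses of [Lset] only isolation is left for the least point: by [gamma_limitE], the
     second would make zero a successor. *)
  by case: (@Lset_zero _ gamma) => // /gamma_limitE[a /pt_inj[h _]]; case: (@zero_lim _ gamma a).
Qed.

End TwoLevels.

(** * The lexicographic square *)

Section LexSquare.
Context {d : Order.disp_t} {gamma : infiniteCardinalType d}.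
Implicit Types (a b : gamma) (x y z w : code gamma).

Local Notation M := (order_topology (Lprec gamma *l Lprec gamma)).

Definition lexpt x z : M := (code_L x, code_L z).

Lemma code_L_lt x y : ((code_L x : Lprec gamma) < code_L y) = code_lt x y.
Proof. by rewrite Lprec_ltE; apply/asboolP/idP => /prec_codeE. Qed.

Lemma lexpt_lt x z y w :
  lexpt x z < lexpt y w <-> code_lt x y \/ x = y /\ code_lt z w.
Proof.
rewrite -[_ < _]/(((code_L x, code_L z) : Lprec gamma *l Lprec gamma)
  < (code_L y, code_L w)) ltEprodlexi /= leNgt [in X in _ && X]leNgt !code_L_lt.
have [->|xy|yx] := code_lt_total x y.
- by rewrite code_lt_irr /=; split=> [|[|[]]//]; right.
- rewrite xy (_ : code_lt y x = false) /=; first by split=> // _; left.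
  by apply/negP => /(code_lt_trans xy); rewrite code_lt_irr.
- rewrite yx /=; split=> // -[xy|[xy _]].
    by have := code_lt_trans xy yx; rewrite code_lt_irr.
  by rewrite xy code_lt_irr in yx.
Qed.

Lemma lexpt_surj (v : M) : exists x z, v = lexpt x z.
Proof.
case: v => u v; have [x <-] := code_L_surj u; have [z <-] := code_L_surj v.
by exists x, z.
Qed.

Lemma lexpt_inj x z y w : lexpt x z = lexpt y w -> x = y /\ z = w.
Proof. by case=> /code_pt_inj -> /code_pt_inj ->. Qed.

Lemma nbhs_lexpt l l' x z u u' U :
  lexpt l l' < lexpt x z -> lexpt x z < lexpt u u' ->
  (forall y w, lexpt l l' < lexpt y w -> lexpt y w < lexpt u u' -> U (lexpt y w)) ->
  nbhs (lexpt x z) U.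
Proof.
move=> lx xu lU; apply: (nbhs_between lx xu) => v.
by have [y [w ->]] := lexpt_surj v; exact: lU.
Qed.

Lemma lexpt_left x z y w U : lexpt y w < lexpt x z -> nbhs (lexpt x z) U ->
  exists l l', lexpt l l' < lexpt x z /\ forall y w, lexpt l l' < lexpt y w ->
    lexpt y w < lexpt x z \/ (y = x /\ w = z) -> U (lexpt y w).
Proof.
move=> yx /(nbhs_left yx)[v]; have [l [l' ->]] := lexpt_surj v => lx lU.
exists l, l'; split=> // y' w' h1 h2; apply: lU => //.
by case: h2 => [|[-> ->]]; [exact: ltW|exact: lexx].
Qed.

Lemma lexpt_row_between x l u y w : lexpt x l < lexpt y w -> lexpt y w < lexpt x u ->
  [/\ y = x, code_lt l w & code_lt w u].
Proof.
move=> /lexpt_lt[xy|[<- lw]] /lexpt_lt[yx|[e wu]]; last by [].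
- by have := code_lt_trans xy yx; rewrite code_lt_irr.
- by rewrite e code_lt_irr in xy.
- by rewrite code_lt_irr in yx.
Qed.

Definition row x : set M := lexpt x @` setT.
(** The first point of a row is kept apart: it may be a limit of earlier rows, while the rest of the
    row is always open. *)
Definition row' x : set M := lexpt x @` [set z | z <> Bot].

Lemma lt_Bot x : code_lt x Bot = false.
Proof. by case: x. Qed.

Lemma Bot_lt x : x <> Bot -> code_lt Bot x.
Proof. by case: x. Qed.

Lemma lim_nbhd_above a b : exists2 l, code_lt l (Lim a) &
  forall z, code_lt l z -> z = Lim a \/ code_lt z (Lim a) -> lim_nbhd a b z.
Proof.
have [b1 hb1] := Iso_tail a b; exists (Iso a b1); first exact: lexx.
move=> z h [->|]; first by left.
case: z h => [||a' b'|a'] //= h1 h2.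
  have aa' : a = a' by move: h1 h2; case: (ltgtP a a').
  by right; exists b'; rewrite ?aa'//; apply: hb1; rewrite [X in code_lt _ (Iso X _)]aa'.
by move: h1; rewrite leNgt h2.
Qed.

Lemma top_nbhd_above a z : code_lt (Lim a) z -> top_nbhd a z.
Proof.
case: z => [||a' b|a'] //= h; first by left.
  by right; exists a'; [exact: ltW|right; exists b; rewrite ?zero_le].
by right; exists a'; [exact: ltW|left].
Qed.

Lemma lim_nbhd_below a l : code_lt l (Lim a) ->
  exists b, forall z, lim_nbhd a b z -> code_lt l z.
Proof.
move=> la; have [b hb] := Lim_cofinal la.
by exists b => z [->//|[b' bb' ->]]; exact: hb.
Qed.

Lemma lim_nbhd_le a b z : lim_nbhd a b z -> z = Lim a \/ code_lt z (Lim a).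
Proof. by move=> [->|[b' _ ->]]; [left|right => /=]. Qed.

Lemma top_nbhd_below l : code_lt l Top ->
  exists a, forall z, top_nbhd a z -> code_lt l z.
Proof.
move=> lt; have [a ha] := Top_cofinal lt.
by exists a => z [->//|[a' /ha[h1 h2]] [->//|[b _ ->]]].
Qed.

Lemma le_Top z : z = Top \/ code_lt z Top.
Proof. by case: z => [||a b|a]; [right|left|right|right]. Qed.

(** Gaps isolate the points [Iso a b], and cofinality handles the limits. The last point of the row
    is cut off from above by the first point of the next row, unless x is [Top]. *)
Lemma nstar2_row' x : nstar gamma 2 (row' x).
Proof.
have rowlt z w : code_lt z w -> lexpt x z < lexpt x w.
  by move=> h; apply/lexpt_lt; right.
apply: nstar2_code.
- by move=> z w /lexpt_inj[].
- move=> a b; have [w1 g1] := gap_left a b.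
  have [|w2 g2] := @gap_right _ gamma (Iso a b) => //.
  apply: (@nbhs_lexpt x w1 _ _ x w2); [by apply: rowlt; case: g1|by apply: rowlt; case: g2|].
  move=> y w h1 h2; have [-> h3 h4] := lexpt_row_between h1 h2.
  by rewrite (gap_eq g1 g2 h3 h4).
- move=> a b; have [w2 g2] : exists w, gap (Lim a) w by exact: gap_right.
  have [l la lP] := lim_nbhd_above a b.
  apply: (@nbhs_lexpt x l _ _ x w2); [exact: rowlt|by apply: rowlt; case: g2|].
  move=> y w h1 h2; have [-> h3 h4] := lexpt_row_between h1 h2.
  exists w => //; apply: lP => //.
  by have [|h|h] := code_lt_total w (Lim a); [left|right|case: g2 => _ /(_ w h h4)].
- move=> a U Ua; have [l [l' [lx lU]]] := lexpt_left (rowlt Bot (Lim a) isT) Ua.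
  have [b hb] : exists b, forall z, lim_nbhd a b z -> lexpt l l' < lexpt x z.
    move/lexpt_lt: lx => [lx|[-> /lim_nbhd_below[b hb]]].
      by exists zero => z _; apply/lexpt_lt; left.
    by exists b => z /hb /rowlt.
  exists b => _ [z zb <-]; apply: lU; first exact: hb.
  by case: (lim_nbhd_le zb) => [->|/rowlt]; [right|left].
- move=> a; have [->|xt] := pselect (x = Top).
    apply: (@nbhs_above _ _ _ (lexpt Top (Lim a))); first by apply/lexpt_lt; right.
    move=> v; have [y [w ->]] := lexpt_surj v => /lexpt_lt[|[<- h]]; first by case: y.
    by exists w => //; exact: top_nbhd_above.
  have [x' g] := gap_right xt.
  apply: (@nbhs_lexpt x (Lim a) _ _ x' Bot); first exact: rowlt.
    by apply/lexpt_lt; left; case: g.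
  move=> y w /lexpt_lt[h1|[<- h1]] /lexpt_lt[h2|[_]]; rewrite ?lt_Bot//.
    by case: g => _ /(_ y h1 h2).
  by exists w => //; exact: top_nbhd_above.
- move=> U Ut; have [l [l' [lx lU]]] := lexpt_left (rowlt Bot Top isT) Ut.
  have [a ha] : exists a, forall z, top_nbhd a z -> lexpt l l' < lexpt x z.
    move/lexpt_lt: lx => [lx|[-> /top_nbhd_below[a ha]]].
      by exists zero => z _; apply/lexpt_lt; left.
    by exists a => z /ha /rowlt.
  exists a => _ [z za <-]; apply: lU; first exact: ha.
  by case: (le_Top z) => [->|/rowlt]; [right|left].
Qed.

(** For x = [Iso a b] the point is alone between the last point of the preceding row, given by
    [gap_left], and the second point of its own row. *)
Lemma nbhs_Bot x : x = Bot \/ (exists a b, x = Iso a b) ->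
  nbhs (lexpt x Bot) [set lexpt x Bot].
Proof.
have [w g] : exists w, @gap _ gamma Bot w by exact: gap_right.
have onlyBot v : code_lt v w -> v = Bot.
  move=> vw; apply: contrapT => /Bot_lt h; by case: g => _ /(_ v h vw).
have up y : lexpt y Bot < lexpt y w by apply/lexpt_lt; right; split => //; case: g.
move=> [->|[a [b ->]]].
  apply: (nbhs_below (up Bot)) => v; have [y [z ->]] := lexpt_surj v.
  by move=> /lexpt_lt[|[-> /onlyBot ->//]]; rewrite lt_Bot.
have [w1 g1] := gap_left a b.
apply: (@nbhs_lexpt w1 Top _ _ (Iso a b) w) => //.
  by apply/lexpt_lt; left; case: g1.
move=> y z /lexpt_lt[h1|[_]]; last by case: z.
move=> /lexpt_lt[h2|[-> /onlyBot ->//]].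
by case: g1 => _ /(_ y h1 h2).
Qed.

Lemma rowE x : row x = row' x `|` [set lexpt x Bot].
Proof.
apply/seteqP; split=> [_ [z _ <-]|_ [[z _ <-]|->]]; last 2 first.
- by exists z.
- by exists Bot.
by have [->|zB] := pselect (z = Bot); [right|left; exists z].
Qed.

Lemma row'_Bot x y : ~ row' x (lexpt y Bot).
Proof. by move=> [z zB /lexpt_inj[_ /zB]]. Qed.

Lemma nstar2_row x : x = Bot \/ (exists a b, x = Iso a b) ->
  nstar gamma 2 (row x).
Proof.
move=> xB; rewrite rowE; apply: (@nstar_absorb _ _ _ 0) => //; last first.
- by apply/seteqP; split=> // v [/[swap] -> /row'_Bot].
- exact: nstar2_row'.
- by exists (lexpt x Bot) => //; exact: nbhs_Bot.
Qed.

Lemma rowP x y z : row x (lexpt y z) <-> y = x.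
Proof. by split=> [[w _ /lexpt_inj[->]]|->]//; exists z. Qed.

Lemma row'P x y z : row' x (lexpt y z) <-> y = x /\ z <> Bot.
Proof. by split=> [[w wB /lexpt_inj[-> <-]]|[-> zB]]//; exists z. Qed.

Definition lim_rows a : set M :=
  [set lexpt (Lim a) Bot] `|` \bigcup_b row (Iso a b).

Lemma lim_rowsP a y z : lim_rows a (lexpt y z) <->
  (y = Lim a /\ z = Bot) \/ exists b, y = Iso a b.
Proof.
split=> [[/lexpt_inj[-> ->]|[b _ /rowP->]]|[[-> ->]|[b ->]]].
- by left.
- by right; exists b.
- by left.
- by right; exists b => //; apply/rowP.
Qed.

Lemma nstar3_lim_rows a : nstar gamma 3 (lim_rows a).
Proof.
have [u g] : exists w, @gap _ gamma Bot w by exact: gap_right.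
have onlyBot v : code_lt v u -> v = Bot.
  move=> vu; apply: contrapT => /Bot_lt h; by case: g => _ /(_ v h vu).
exists (lexpt (Lim a) Bot), (fun b => row (Iso a b)); split; last first.
  by move=> b; apply: nstar2_row; right; exists a, b.
split.
- apply/seteqP; split=> v; rewrite tail0P.
    by move=> [|[b _ ?]]; [left|right; exists b].
  by move=> [|[b ?]]; [left|right; exists b].
- by move=> b /rowP.
- by move=> b b' _ [z _ <-] /rowP[].
- move=> b; have [l la lP] := lim_nbhd_above a b.
  (* Between the last point of row l and the second point of row [Lim a] there are only the centre
     and full rows [Iso a b'] with b <= b'. *)
  apply: (@nbhs_lexpt l Top _ _ (Lim a) u); try by apply/lexpt_lt; left.
    by apply/lexpt_lt; right; split => //; case: g.
  move=> y z /lexpt_lt[ly|[_]]; last by case: z.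
  move=> /lexpt_lt[ya|[-> /onlyBot ->]]; last by left.
  have [e|[b' bb' ->]] := lP y ly (or_intror ya).
    by rewrite e code_lt_irr in ya.
  by right; exists b' => //; exact/rowP.
- move=> U Ua; have [|l [l' [lx lU]]] := @lexpt_left _ _ Bot Bot U _ Ua.
    by apply/lexpt_lt; left.
  move/lexpt_lt: lx => [la|[_]]; last by rewrite lt_Bot.
  have [b hb] := Lim_cofinal la; exists b => v [->|[b' bb' [z _ <-]]].
    exact: nbhs_singleton.
  by apply: lU; [|left]; apply/lexpt_lt; left => //=; exact: hb.
Qed.

(** Completes the row of [Lim a]; the added part has rank two and is absorbed. *)
Definition lim_rows' a : set M := lim_rows a `|` row' (Lim a).

Lemma lim_rows'P a y z : lim_rows' a (lexpt y z) <->
  y = Lim a \/ exists b, y = Iso a b.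
Proof.
split=> [[/lim_rowsP[[-> _]|[b ->]]|/row'P[-> _]]|[->|[b ->]]].
- by left.
- by right; exists b.
- by left.
- have [->|zB] := pselect (z = Bot); [left|right; exact/row'P].
  by apply/lim_rowsP; left.
- by left; apply/lim_rowsP; right; exists b.
Qed.

Lemma nstar3_lim_rows' a : nstar gamma 3 (lim_rows' a).
Proof.
apply: (@nstar_absorb _ _ _ 2) => //; [exact: nstar2_row'|exact: nstar3_lim_rows|].
apply/seteqP; split=> // v [+ [z zB vE]]; rewrite -{}vE.
by move=> /lim_rowsP[[_ /zB]|[]].
Qed.

Definition below_top : set M :=
  [set lexpt Top Bot] `|` \bigcup_a lim_rows' a.

Lemma nstar4_below_top : nstar gamma 4 below_top.
Proof.
have [u g] : exists w, @gap _ gamma Bot w by exact: gap_right.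
have onlyBot v : code_lt v u -> v = Bot.
  move=> vu; apply: contrapT => /Bot_lt h; by case: g => _ /(_ v h vu).
exists (lexpt Top Bot), lim_rows'; split; last exact: nstar3_lim_rows'.
split.
- apply/seteqP; split=> v; rewrite tail0P.
    by move=> [|[b _ ?]]; [left|right; exists b].
  by move=> [|[b ?]]; [left|right; exists b].
- by move=> a /lim_rows'P[|[]].
- move=> a a' v; have [y [z ->]] := lexpt_surj v.
  by move=> /lim_rows'P[->|[b ->]] /lim_rows'P[[]|[b' []]].
- move=> a; apply: (@nbhs_lexpt (Lim a) Top _ _ Top u); try by apply/lexpt_lt; left.
    by apply/lexpt_lt; right; split => //; case: g.
  move=> y z /lexpt_lt[ly|[_]]; last by case: z.
  move=> /lexpt_lt[ya|[-> /onlyBot ->]]; last by left.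
  case: (top_nbhd_above ly) => [e|[a' aa' ya']]; first by rewrite e in ya.
  right; exists a' => //; apply/lim_rows'P.
  by case: ya' => [->|[b _ ->]]; [left|right; exists b].
- move=> U Ua; have [|l [l' [lx lU]]] := @lexpt_left _ _ Bot Bot U _ Ua.
    by apply/lexpt_lt; left.
  move/lexpt_lt: lx => [la|[_]]; last by rewrite lt_Bot.
  have [a ha] := Top_cofinal la; exists a => v [->|[a' /ha[h1 h2] +]].
    exact: nbhs_singleton.
  have [y [z ->]] := lexpt_surj v => /lim_rows'P[->|[b ->]];
  by apply: lU; [|left]; apply/lexpt_lt; left.
Qed.

Lemma nstar4_lex : nstar gamma 4 [set: M].
Proof.
(* The first row and the rest of the last row belong to no block; both have rank two and are
   absorbed. *)
have -> : [set: M] = below_top `|` row Bot `|` row' Top.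
  apply/seteqP; split=> // v _; have [y [z ->]] := lexpt_surj v.
  case: y => [||a b|a].
  - by left; right; exact/rowP.
  - have [->|zB] := pselect (z = Bot); first by left; left; left.
    by right; exact/row'P.
  - by left; left; right; exists a => //; apply/lim_rows'P; right; exists b.
  - by left; left; right; exists a => //; apply/lim_rows'P; left.
apply: (@nstar_absorb _ _ _ 2) => //; first exact: nstar2_row'.
  apply: (@nstar_absorb _ _ _ 2) => //; first by apply: nstar2_row; left.
    exact: nstar4_below_top.
  apply/seteqP; split=> // v [+ [z _ vE]]; rewrite -{}vE.
  by move=> [/lexpt_inj[]|[a _ /lim_rows'P[|[]]]].
apply/seteqP; split=> // v [+ [z zB vE]]; rewrite -{}vE.
by move=> [[/lexpt_inj[_ /zB]|[a _ /lim_rows'P[|[]]]]|/rowP].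
Qed.

End LexSquare.

Theorem lemma2p6 (d : Order.disp_t) (gamma : infiniteCardinalType d) :
  homeomorphic (set_type (Lset gamma) * set_type (Lset gamma))%type
    (order_topology (Lprec gamma *l Lprec gamma)).
Proof.
apply: (@nstar_homeomorphic _ gamma _ _ 4); last exact: nstar4_lex.
have := nstar_prod (@nstar2_Lset _ gamma) (@nstar2_Lset _ gamma).
by rewrite setXTT.
Qed.
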